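(* Let $P=-\Delta+V$ on $\mathbb{R}^n$ with $V$ a real-valued smooth function such that $V=V_\infty+V_s$, where $V_\infty$ is real-valued, smooth, and satisfies $V_\infty(x)=V_\infty(x/|x|)$ for $|x|\ge1$, and $V_s(x)=o(|x|^{-1})$ as $|x|\to\infty$. Let $\Omega\subset\mathbb{R}^n$ be a domain such that $$\Omega\cap\{x\in\mathbb{R}^n\mid |x|>R\}\subset\mathbb{R}^n\setminus\{(r,\theta)\in\mathbb{R}^n\mid r>R,\ \mathrm{dist}(\theta,\theta_0)<Cr^{-\ell}\}$$ for some $R,C>0$, $0<\ell<1$ and $\theta_0\in S^{n-1}$. Then the observability estimate on $\Omega$ fails for any $T>0$; that is, for any $T>0$ there exist $u_m\in L^2(\mathbb{R}^n)$, $m\in\mathbb{N}$, such that $\|u_m\|_{L^2(\mathbb{R}^n)}=1$ and $$\int_0^T\int_\Omega|e^{-itP}u_m(x)|^2\,\mathrm{d}x\,\mathrm{d}t\to0\quad\text{as } m\to\infty.$$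
   Context: $(r,\theta)$ denotes polar coordinates $x=r\theta$, $r>0$, $\theta\in S^{n-1}$. $\mathrm{dist}$ is the distance on $S^{n-1}$ defined by the Riemannian metric induced from the Euclidean metric of $\mathbb{R}^n$. $e^{-itP}$ is the unitary group generated by the self-adjoint operator $P$ on $L^2(\mathbb{R}^n)$. The observability estimate on $\Omega$ at time $T$ is: there is $C_{\Omega,T}>0$ with $\|u\|_{L^2(\mathbb{R}^n)}^2\le C_{\Omega,T}\int_0^T\int_\Omega|e^{-itP}u(x)|^2\,\mathrm{d}x\,\mathrm{d}t$ for all $u\in L^2(\mathbb{R}^n)$. *)

(* Defs.v *)
From HB Require Import structures.
From mathcomp Require Import all_boot all_order all_algebra.
From mathcomp Require Import complex.
From mathcomp Require Import all_classical all_reals all_analysis.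
From mathcomp Require Import measurable_realfun.

Set Implicit Arguments.
Unset Strict Implicit.
Unset Printing Implicit Defensive.

Import Order.TTheory GRing.Theory Num.Theory.
Import numFieldNormedType.Exports.

Local Open Scope classical_set_scope.
Local Open Scope ring_scope.

(* R^n is 'rV[R]_n.  The library topologizes it with the sup norm, hence with
   the usual topology; the Euclidean norm has to be defined. *)
Definition enorm (R : realType) (n : nat) (x : 'rV[R]_n) : R :=
  Num.sqrt (\sum_(i < n) x ord0 i ^+ 2).

(* The product sigma-algebra of the Borel sigma-algebras of the coordinates,
   as the library does for n.-tuple R; it is the Borel sigma-algebra of R^n
   (see open_measurable_rV below). *)
Section measurable_rV.
Variables (R : realType) (n : nat).

Definition rV_coord (i : 'I_n) (x : 'rV[R]_n) : measurableTypeR R := x ord0 i.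

Let rV_set0 : g_sigma_preimage rV_coord set0.
Proof. exact: sigma_algebra0. Qed.

Let rV_setC A : g_sigma_preimage rV_coord A -> g_sigma_preimage rV_coord (~` A).
Proof. exact: sigma_algebraC. Qed.

Let rV_bigcup (F : (set 'rV[R]_n)^nat) :
  (forall i, g_sigma_preimage rV_coord (F i)) ->
  g_sigma_preimage rV_coord (\bigcup_i (F i)).
Proof. exact: sigma_algebra_bigcup. Qed.

HB.instance Definition _ := @isMeasurable.Build default_measure_display
  'rV[R]_n (g_sigma_preimage rV_coord) rV_set0 rV_setC rV_bigcup.

End measurable_rV.

Lemma measurable_rV_coord (R : realType) (n : nat) (i : 'I_n) :
  measurable_fun [set: 'rV[R]_n] (@rV_coord R n i).
Proof.
move=> _ Y mY; rewrite setTI; apply: sub_sigma_algebra => /=.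
rewrite -bigcup_seq/=; exists i => /=; first by rewrite mem_index_enum.
by exists Y => //; rewrite setTI.
Qed.

Lemma measurable_fun_rVP (R : realType) d (T : measurableType d) n
    (f : T -> 'rV[R]_n) :
  (forall i, measurable_fun [set: T] (@rV_coord R n i \o f)) ->
  measurable_fun [set: T] f.
Proof.
move=> mf.
have /= H : g_sigma_preimage (fun i => @rV_coord R n i \o f) `<=` measurable.
  apply: smallest_sub; first exact: sigma_algebra_measurable.
  case: n => [|n] in f mf *; first by rewrite big_ord0.
  rewrite -bigcup_mkord_ord; apply: bigcup_sub => i Ii.
  by move=> A [B mB <-]; exact: mf.
rewrite g_sigma_preimage_comp in H.
by move=> _ A mA; apply: H; exists A.
Qed.

Lemma open_measurable_rV (R : realType) (n : nat) (A : set 'rV[R]_n) :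
  open A -> measurable A.
Proof.
move=> oA.
pose box (q : 'rV[rat]_n) (k : nat) : set 'rV[R]_n :=
  [set x | forall i, ball (ratr (q ord0 i) : R) k.+1%:R^-1 (x ord0 i)].
have mbox q k : measurable (box q k).
  rewrite (_ : box q k = \big[setI/setT]_(i < n)
      (@rV_coord R n i @^-1` ball (ratr (q ord0 i) : R) k.+1%:R^-1)); last first.
    rewrite -bigcap_seq; apply/seteqP; split=> x /= xb i; first by move=> _; exact: xb.
    by apply: xb => /=; rewrite mem_index_enum.
  apply: bigsetI_measurable => i _; rewrite -[X in measurable X]setTI.
  by apply: measurable_rV_coord => //; exact: open_measurable (ball_open _ _).
pose G (p : nat) : set 'rV[R]_n :=
  if @unpickle ('rV[rat]_n * nat)%type p is Some (q, k) then
    [set x | box q k x /\ box q k `<=` A] else set0.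
rewrite (_ : A = \bigcup_p G p).
  apply: bigcupT_measurable => p; rewrite /G.
  case: (unpickle p) => [[q k]|//].
  have [sA|nsA] := pselect (box q k `<=` A).
    rewrite (_ : [set x | _] = box q k)//.
    by apply/seteqP; split=> x //= [].
  rewrite (_ : [set x | _] = set0)//.
  by apply/seteqP; split=> x //= [].
apply/seteqP; split=> x; last first.
  by move=> [p _]; rewrite /G; case: (unpickle p) => [[q k] [xb]|//]; apply.
move=> Ax; have /nbhs_ballP[e /= e0 eA] : nbhs x A by exact: open_nbhs_nbhs.
have e20 : 0 < e / 2 by rewrite divr_gt0.
have [k _ /(_ k (leqnn _))/= ke] := near_infty_natSinv_lt (PosNum e20).
have /choice[q qx] (i : 'I_n) :
    exists q : rat, ball (x ord0 i) k.+1%:R^-1 (ratr q : R).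
  have [||z [bz [r _ rz]]] := @dense_rat R (ball (x ord0 i) k.+1%:R^-1).
  - by exists (x ord0 i); apply: ballxx; rewrite invr_gt0.
  - exact: ball_open.
  - by exists r; rewrite rz.
exists (pickle (\row_i q i, k)) => //; rewrite /G pickleK; split => [i|y yb].
  by rewrite mxE; exact/ball_sym/qx.
apply: eA; split=> // i j; rewrite (ord1 i).
apply: (@le_ball _ _ _ (k.+1%:R^-1 + k.+1%:R^-1)).
  by rewrite [leRHS]splitr lerD// ltW.
by apply: (ball_triangle (qx j)); have := yb j; rewrite mxE.
Qed.

Definition rV_rcons (R : realType) (n : nat)
    (p : 'rV[R]_n * measurableTypeR R) : 'rV[R]_n.+1 :=
  \row_i (if unlift ord_max i is Some j then p.1 ord0 j else p.2).

Lemma measurable_rV_rcons (R : realType) (n : nat) :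
  measurable_fun [set: 'rV[R]_n * measurableTypeR R] (@rV_rcons R n).
Proof.
apply: measurable_fun_rVP => i.
case: (unliftP ord_max i) => [j ->|->].
  rewrite (_ : _ \o _ = @rV_coord R n j \o fst).
    exact: measurableT_comp (@measurable_rV_coord R n j) measurable_fst.
  by apply/funext => p /=; rewrite /rV_coord/= mxE liftK.
rewrite (_ : _ \o _ = snd); first exact: measurable_snd.
by apply/funext => p /=; rewrite /rV_coord mxE unlift_none.
Qed.


Section lebesgue_rV_step.
Variables (R : realType) (n : nat) (mu : {measure set 'rV[R]_n -> \bar R}).

Definition lebesgue_rV_step : set 'rV[R]_n.+1 -> \bar R :=
  pushforward (mu \x @lebesgue_measure R)%E (@rV_rcons R n).

HB.instance Definition _ := Measure.copy lebesgue_rV_step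
  (measure_function_pushforward__canonical__measure_function_Measure
    (mu \x @lebesgue_measure R)%E (@measurable_rV_rcons R n)).

End lebesgue_rV_step.

(* Iterated product of the Lebesgue measure of R; see lebesgue_rV_box for its
   values on boxes, which characterize it. *)
Fixpoint lebesgue_rV (R : realType) (n : nat) :
    {measure set 'rV[R]_n -> \bar R} :=
  match n with
  | 0%N => \d_(0 : 'rV[R]_0)
  | m.+1 => lebesgue_rV_step (lebesgue_rV R m)
  end.

Lemma lebesgue_rV_box (R : realType) (n : nat) (B : 'I_n -> set (measurableTypeR R)) :
  (forall i, measurable (B i)) ->
  lebesgue_rV R n [set x | forall i, B i (x ord0 i)] =
  (\prod_(i < n) lebesgue_measure (B i))%E.
Proof.
elim: n B => [|n IHn] B mB.
  rewrite big_ord0 /= diracE mem_set//; by case.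
rewrite big_ord_recr/= /lebesgue_rV_step /pushforward.
rewrite (_ : _ @^-1` _ = [set x : 'rV[R]_n | forall i,
    B (widen_ord (leqnSn n) i) (x ord0 i)] `*` B ord_max); last first.
  apply/seteqP; split=> -[x y] /=.
    move=> xyB; split => [i|].
      have := xyB (widen_ord (leqnSn n) i); rewrite mxE.
      rewrite (_ : widen_ord _ i = lift ord_max i) ?liftK//.
      by apply/val_inj; rewrite /= /bump leqNgt ltn_ord.
    by have := xyB ord_max; rewrite mxE unlift_none.
  move=> [xB yB] i; rewrite mxE; case: unliftP => [j|] -> //.
  have := xB j; rewrite (_ : widen_ord _ j = lift ord_max j)//.
  by apply/val_inj; rewrite /= /bump leqNgt ltn_ord.
rewrite product_measure1E//; first by rewrite -IHn.
rewrite (_ : [set x | _] = \big[setI/setT]_(i < n)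
    (@rV_coord R n i @^-1` B (widen_ord (leqnSn n) i))); last first.
  rewrite -bigcap_seq; apply/seteqP; split=> x /= xb i; first by move=> _; exact: xb.
  by apply: xb => /=; rewrite mem_index_enum.
apply: bigsetI_measurable => i _; rewrite -[X in measurable X]setTI.
exact: measurable_rV_coord.
Qed.

Definition partial (R : realType) (n : nat) (i : 'I_n) (f : 'rV[R]_n -> R) :
    'rV[R]_n -> R :=
  fun x => 'D_(delta_mx ord0 i) f x.

(* C^oo: all iterated partial derivatives exist and are (totally)
   differentiable, hence continuous. *)
Definition smooth (R : realType) (n : nat) (f : 'rV[R]_n -> R) : Prop :=
  forall (s : seq 'I_n) (x : 'rV[R]_n),
    differentiable (foldr (@partial R n) f s) x.

Definition laplacian (R : realType) (n : nat) (f : 'rV[R]_n -> R) :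
    'rV[R]_n -> R :=
  fun x => \sum_(i < n) partial i (partial i f) x.

Section complex_functions.
Local Open Scope complex_scope.
Variables (R : realType) (n : nat).
Implicit Types f g : 'rV[R]_n -> R[i].

Definition re_part f : 'rV[R]_n -> R := fun x => complex.Re (f x).
Definition im_part f : 'rV[R]_n -> R := fun x => complex.Im (f x).

Definition L2norm f : \bar R :=
  Lnorm (lebesgue_rV R n) 2%:E (fun x => (Normc.normc (f x))%:E).

(* Elements of L^2(R^n) are handled through representatives; norms,
   inner products, operators and groups below only see the classes of
   measurable functions modulo almost everywhere equality. *)
Definition inL2 f : Prop :=
  [/\ measurable_fun [set: 'rV[R]_n] (re_part f : _ -> measurableTypeR R),
      measurable_fun [set: 'rV[R]_n] (im_part f : _ -> measurableTypeR R)
    & (L2norm f < +oo)%E].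

Definition eq_ae f g : Prop := {ae lebesgue_rV R n, forall x, f x = g x}.

Definition L2dot f g : R[i] :=
  (\int[lebesgue_rV R n]_x complex.Re (f x * (g x)^*)) +i*
  (\int[lebesgue_rV R n]_x complex.Im (f x * (g x)^*)).

Definition test_function f : Prop :=
  [/\ smooth (re_part f), smooth (im_part f)
    & exists M : R, forall x, M < enorm x -> f x = 0].

Definition schrodinger (V : 'rV[R]_n -> R) f : 'rV[R]_n -> R[i] :=
  fun x => - (laplacian (re_part f) x +i* laplacian (im_part f) x)
           + (V x)%:C * f x.

(* An unbounded operator is given by its graph: P f g means that f is in the
   domain of P and P f = g.  The equivalence says that the graph of P is the
   graph of its adjoint; with the density of the domain this is
   self-adjointness (domains included). *)
Definition selfadjoint
    (P : ('rV[R]_n -> R[i]) -> ('rV[R]_n -> R[i]) -> Prop) : Prop :=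
  (forall f, inL2 f -> forall e : R, 0 < e ->
     exists u v, P u v /\ (L2norm (fun x => (f x - u x)%R) < e%:E)%E) /\
  (forall f g, P f g <->
     [/\ inL2 f, inL2 g & forall u v, P u v -> L2dot v f = L2dot u g]).

(* The self-adjoint operator P = -Delta + V on L^2(R^n).  If V is smooth and
   bounded then -Delta + V is essentially self-adjoint on the space of test
   functions, so exactly one P satisfies this; its domain is H^2(R^n). *)
Definition schrodinger_operator (V : 'rV[R]_n -> R)
    (P : ('rV[R]_n -> R[i]) -> ('rV[R]_n -> R[i]) -> Prop) : Prop :=
  selfadjoint P /\ (forall f, test_function f -> P f (schrodinger V f)).

Record unitary_group (U : R -> ('rV[R]_n -> R[i]) -> ('rV[R]_n -> R[i])) :
    Prop := UnitaryGroup {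
  unitary_group_L2 : forall t f, inL2 f -> inL2 (U t f) ;
  unitary_group_linear : forall t (a : R[i]) f g, inL2 f -> inL2 g ->
    eq_ae (U t (fun x => a * f x + g x)) (fun x => a * U t f x + U t g x) ;
  unitary_group_isometry : forall t f, inL2 f -> L2norm (U t f) = L2norm f ;
  unitary_group0 : forall f, inL2 f -> eq_ae (U 0 f) f ;
  unitary_groupD : forall s t f, inL2 f -> eq_ae (U (s + t) f) (U s (U t f)) ;
  unitary_group_continuous : forall f, inL2 f ->
    L2norm (fun x => U t f x - f x) @[t --> (0 : R)] --> 0%E
}.

(* U t = e^{-itP} in the sense of Stone's theorem: U is the strongly continuous
   unitary group whose infinitesimal generator is -iP, domains included. *)
Definition generated_by
    (P : ('rV[R]_n -> R[i]) -> ('rV[R]_n -> R[i]) -> Prop)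
    (U : R -> ('rV[R]_n -> R[i]) -> ('rV[R]_n -> R[i])) : Prop :=
  unitary_group U /\
  (forall f g, P f g <->
     [/\ inL2 f, inL2 g &
         L2norm (fun x => (t^-1)%:C * (U t f x - f x) - (- 'i * g x))
           @[t --> (0 : R)^'] --> 0%E]).

Definition observed_energy
    (U : R -> ('rV[R]_n -> R[i]) -> ('rV[R]_n -> R[i]))
    (Omega : set 'rV[R]_n) (T : R) f : \bar R :=
  (\int[@lebesgue_measure R]_(t in `[0%R, T]) \int[lebesgue_rV R n]_(x in Omega)
     ((Normc.normc (U t f x)) ^+ 2)%R%:E)%E.

Definition observability
    (U : R -> ('rV[R]_n -> R[i]) -> ('rV[R]_n -> R[i]))
    (Omega : set 'rV[R]_n) (T : R) : Prop :=
  exists C : R, 0 < C /\ forall f, inL2 f ->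
    (L2norm f ^+ 2 <= C%:E * observed_energy U Omega T f)%E.

End complex_functions.

Definition euclidean_domain (R : realType) (n : nat) (Omega : set 'rV[R]_n) :
    Prop :=
  [/\ open Omega, connected Omega & Omega !=set0].

(* C^1 curves on the unit sphere from theta to eta, parametrized by [0, 1].
   Vanishing velocity is allowed, so these have the same lengths as piecewise
   C^1 curves; a C^1 map on [0, 1] is the restriction of one on R. *)
Definition sphere_curve (R : realType) (n : nat) (theta eta : 'rV[R]_n)
    (c : R -> 'rV[R]_n) : Prop :=
  [/\ (forall t, derivable c t 1), continuous (fun t => 'D_1 c t),
      (forall t, 0 <= t <= 1 -> enorm (c t) = 1), c 0 = theta & c 1 = eta].

Definition curve_length (R : realType) (n : nat) (c : R -> 'rV[R]_n) : \bar R :=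
  (\int[@lebesgue_measure R]_(t in `[0%R, 1%R]) (enorm ('D_1 c t))%:E)%E.

(* Riemannian distance on the unit sphere; +oo if no curve joins the points,
   which only happens for the two points of S^0. *)
Definition sphere_dist (R : realType) (n : nat) (theta eta : 'rV[R]_n) :
    \bar R :=
  ereal_inf [set curve_length c | c in sphere_curve theta eta].

Definition horn (R : realType) (n : nat) (rad C l : R) (theta0 : 'rV[R]_n) :
    set 'rV[R]_n :=
  [set x | rad < enorm x /\
    (sphere_dist ((enorm x)^-1 *: x) theta0 < (C * (enorm x) `^ (- l))%:E)%E].

Definition o_inv_norm (R : realType) (n : nat) (f : 'rV[R]_n -> R) : Prop :=
  forall e : R, 0 < e -> exists M : R, forall x : 'rV[R]_n,
    M < enorm x -> `|f x| <= e * (enorm x)^-1.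

(* Main.v *)
Require Import Defs.
From mathcomp Require Import all_boot all_order all_algebra.
From mathcomp Require Import complex.
From mathcomp Require Import all_classical all_reals all_analysis.
From mathcomp Require Import measurable_realfun ring lra.

Set Implicit Arguments.
Unset Strict Implicit.
Unset Printing Implicit Defensive.

Import Order.TTheory GRing.Theory Num.Theory.
Import numFieldNormedType.Exports.

Local Open Scope classical_set_scope.
Local Open Scope ring_scope.

(** Fix a time T.  A solution that moves little during [0, T] and starts inside
the horn is almost invisible from Omega, so it suffices to find almost
stationary states: unit vectors u of the domain of P supported in the horn with
(P - c) u small, c being a constant.  Such a quasimode obeys
  || e^{-itP} u - z u || <= t || (P - c) u ||   for some scalar z,
up to an arbitrarily small error (quasimode_evolution), and since u vanishes on
Omega the left-hand side bounds the L^2 norm of e^{-itP} u on Omega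
(observed_energy_le).

The quasimodes are wide cutoffs.  At distance r from the origin the horn has
width of order r^(1 - l), which is unbounded because l < 1; hence the horn
contains cubes of any half-side L, with centre a = r theta0 and r large.  On
such a cube x / |x| is close to theta0, so that V, which is Vinf (x / |x|) up to
a term tending to 0 at infinity, is close to the constant c = Vinf theta0
(box_in_horn).  A smooth bump function rescaled to this cube then satisfies
|| Delta u || = O(L^-2) || u || and || (V - c) u || <= eps || u ||
(cutoff_quasimode).  Letting L tend to infinity and eps to 0 proves the
convergence of the energies, and this convergence contradicts observability.

The evolution bound comes from the implicit Euler scheme.  With
a_h = (1 + ich)^-1, a contraction that agrees with e^{-ich} to first order, the
vector U_h f - a_h f is h times a vector whose norm tends to || (P - c) f ||
as h tends to 0, by definition of the generator (L2norm_resolvent_step);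
the error after k steps of length h is at most k times the one-step error
because U is unitary (L2norm_iter_sub), and it remains to take h = t / N.

The distance on the sphere is an infimum of lengths, so it is bounded above by
the length of one curve: the chord, projected radially (sphere_dist_le). *)

(** * Integrals and the L^2 norm *)

(** The integral of a nonnegative function is a supremum over the simple
functions below it, so it is monotone even for non-measurable integrands.  It is
applied to the energy in Omega as a function of time, about whose measurability
nothing is assumed. *)
Lemma ge0_le_integralW d (T : measurableType d) (R : realType)
    (mu : {measure set T -> \bar R}) (D : set T) (f g : T -> \bar R) :
  (forall x, D x -> 0 <= f x)%E -> (forall x, D x -> f x <= g x)%E ->
  (\int[mu]_(x in D) f x <= \int[mu]_(x in D) g x)%E.
Proof.
move=> f0 fg.
have g0 x : D x -> (0 <= g x)%E by move=> Dx; exact: le_trans (f0 _ Dx) (fg _ Dx).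
rewrite !ge0_integralE//; apply: le_ereal_sup => _ [h /= hf <-].
exists h => //= x; apply: (le_trans (hf x)).
by apply: lee_restrict.
Qed.

Section L2.
Variables (R : realType) (n : nat).
Implicit Types f g : 'rV[R]_n -> R[i].
Local Notation mu := (lebesgue_rV R n).
Local Notation normc := Normc.normc.

Lemma normc_ge0 (z : R[i]) : 0 <= normc z.
Proof. by case: z => a b; exact: sqrtr_ge0. Qed.

Lemma normc_real (a : R) : normc a%:C%C = `|a|.
Proof. by rewrite /Normc.normc/= expr0n addr0 sqrtr_sqr. Qed.

Lemma normc_ext f x : normc (f x) = Num.sqrt (re_part f x ^+ 2 + im_part f x ^+ 2).
Proof. by rewrite /re_part /im_part; case: (f x). Qed.

Lemma L2normE f :
  L2norm f = ((\int[mu]_x ((normc (f x)) ^+ 2)%:E) `^ 2^-1)%E.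
Proof.
rewrite /L2norm unlock; congr (_ `^ _)%E; apply: eq_integral => x _ /=.
by rewrite ger0_norm ?normc_ge0// powR_mulrn ?normc_ge0.
Qed.

Lemma L2norm_sqr f : (L2norm f ^+ 2 = \int[mu]_x ((normc (f x)) ^+ 2)%:E)%E.
Proof.
have i0 : (0 <= \int[mu]_x ((normc (f x)) ^+ 2)%:E)%E.
  by apply: integral_ge0 => x _; rewrite lee_fin exprn_ge0// normc_ge0.
by rewrite L2normE poweR12_sqrt// sqr_sqrte.
Qed.

Lemma L2norm_ge0 f : (0 <= L2norm f)%E.
Proof. exact: Lnorm_ge0. Qed.

Lemma le_L2norm f g : (forall x, normc (f x) <= normc (g x)) ->
  (L2norm f <= L2norm g)%E.
Proof.
move=> fg; rewrite !L2normE; apply: gt0_ler_poweR; rewrite ?invr_ge0//.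
- by rewrite in_itv/= leey andbT; apply: integral_ge0 => x _; rewrite lee_fin exprn_ge0// normc_ge0.
- by rewrite in_itv/= leey andbT; apply: integral_ge0 => x _; rewrite lee_fin exprn_ge0// normc_ge0.
- apply: ge0_le_integralW => x _; rewrite lee_fin ?exprn_ge0 ?normc_ge0//.
  by rewrite lerXn2r// nnegrE normc_ge0.
Qed.

Lemma measurable_normc f : inL2 f ->
  measurable_fun setT (fun x => normc (f x) : measurableTypeR R).
Proof.
move=> [mr mi _]; under eq_fun do rewrite normc_ext -powR12_sqrt ?addr_ge0 ?sqr_ge0//.
apply: (measurableT_comp (measurable_powR 2^-1)).
by apply: measurable_funD; exact: measurable_funX.
Qed.

(** Minkowski's inequality for the real functions |f| and |g|, after the
pointwise triangle inequality. *)
Lemma L2normD f g : inL2 f -> inL2 g ->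
  (L2norm (fun x => f x + g x)%R <= L2norm f + L2norm g)%E.
Proof.
move=> Lf Lg; apply: (@le_trans _ _ (L2norm (fun x => (normc (f x) + normc (g x))%:C%C)%R)).
  apply: le_L2norm => x; rewrite normc_real ger0_norm ?addr_ge0 ?normc_ge0//.
  exact: le_normcD.
have := @minkowski_EFin _ _ _ mu _ _ 2 (measurable_normc Lf) (measurable_normc Lg).
rewrite ler1n => /(_ isT); apply: le_trans.
rewrite le_eqVlt; apply/orP; left; apply/eqP; apply: eq_Lnorm => x.
by rewrite [RHS]/comp normc_real ger0_norm ?addr_ge0 ?normc_ge0.
Qed.

Lemma L2normZ (a : R[i]) f : inL2 f ->
  (L2norm (fun x => a * f x)%R = (normc a)%:E * L2norm f)%E.
Proof.
move=> Lf; rewrite !L2normE.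
under eq_integral do rewrite Normc.normcM exprMn EFinM.
rewrite ge0_integralZl//=; last 3 first.
- by apply/measurable_EFinP; apply: measurable_funX; exact: measurable_normc.
- by move=> x _; rewrite lee_fin exprn_ge0// normc_ge0.
- by rewrite lee_fin exprn_ge0// normc_ge0.
rewrite poweRM ?lee_fin ?exprn_ge0 ?normc_ge0//; last first.
  by apply: integral_ge0 => x _; rewrite lee_fin exprn_ge0// normc_ge0.
congr (_ * _)%E; rewrite poweR_EFin; congr EFin.
by rewrite -powR_mulrn ?normc_ge0// -powRrM divff// powRr1 ?normc_ge0.
Qed.

Lemma inL2_lin (a : R[i]) f g : inL2 f -> inL2 g ->
  inL2 (fun x => a * f x + g x).
Proof.
move=> Lf Lg; have [rf jf nf] := Lf; have [rg jg ng] := Lg.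
have LZ : inL2 (fun x => a * f x).
  split.
  - rewrite (_ : re_part _ = (fun x => complex.Re a * re_part f x - complex.Im a * im_part f x)).
      by apply: measurable_funB; apply: measurable_funM.
    by apply/funext => x; rewrite /re_part /im_part; case: a (f x) => ? ? [].
  - rewrite (_ : im_part _ = (fun x => complex.Re a * im_part f x + complex.Im a * re_part f x)).
      by apply: measurable_funD; apply: measurable_funM.
    by apply/funext => x; rewrite /re_part /im_part; case: a (f x) => ? ? [].
  - by rewrite L2normZ// lte_mul_pinfty// ?lee_fin ?normc_ge0.
split.
- rewrite (_ : re_part _ = (fun x => re_part (fun x => a * f x) x + re_part g x)).
    by apply: measurable_funD => //; case: LZ.
  by apply/funext => x; rewrite /re_part; case: (_ * _) (g x) => ? ? [].
- rewrite (_ : im_part _ = (fun x => im_part (fun x => a * f x) x + im_part g x)).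
    by apply: measurable_funD => //; case: LZ.
  by apply/funext => x; rewrite /im_part; case: (_ * _) (g x) => ? ? [].
- apply: le_lt_trans (L2normD LZ Lg) _.
  by rewrite lte_add_pinfty//; case: LZ.
Qed.

Lemma eq_ae_L2norm f g : inL2 f -> inL2 g -> eq_ae f g -> L2norm f = L2norm g.
Proof.
move=> Lf Lg fg; rewrite !L2normE; congr (_ `^ _)%E.
apply: ge0_ae_eq_integral => //=.
- by apply/measurable_EFinP; apply: measurable_funX; exact: measurable_normc.
- by apply/measurable_EFinP; apply: measurable_funX; exact: measurable_normc.
- by move=> x _; rewrite lee_fin exprn_ge0// normc_ge0.
- by move=> x _; rewrite lee_fin exprn_ge0// normc_ge0.
- by apply: filterS fg => x /= -> _.
Qed.

Lemma inL2_subZ (z : R[i]) f g : inL2 f -> inL2 g ->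
  inL2 (fun x => g x - z * f x).
Proof.
move=> Lf Lg; rewrite (_ : (fun _ => _) = (fun x => (- z) * f x + g x)).
  exact: inL2_lin.
by apply/funext => x; rewrite mulNr addrC.
Qed.

Lemma inL2Z (z : R[i]) f : inL2 f -> inL2 (fun x => z * f x).
Proof.
move=> Lf; rewrite (_ : (fun _ => _) = (fun x => (z - 1) * f x + f x)).
  exact: inL2_lin.
by apply/funext => x; rewrite mulrBl mul1r subrK.
Qed.

Lemma inL2D f g : inL2 f -> inL2 g -> inL2 (fun x => f x + g x).
Proof.
move=> Lf Lg; have := inL2_lin 1 Lf Lg; rewrite (_ : (fun _ => _) = (fun x => f x + g x))//.
by apply/funext => x; rewrite mul1r.
Qed.

Lemma inL2_Zsub (z : R[i]) f g : inL2 f -> inL2 g ->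
  inL2 (fun x => z * f x - g x).
Proof.
move=> Lf Lg; rewrite (_ : (fun _ => _) = fun x => z * f x - 1 * g x).
  exact/inL2_subZ/inL2Z.
by apply/funext => x; rewrite mul1r.
Qed.

Lemma normc_i : normc ('i : R[i]) = 1.
Proof. by rewrite -complexiE /Normc.normc/= expr0n expr1n add0r sqrtr1. Qed.

Lemma L2norm_fin f : inL2 f -> (L2norm f = (fine (L2norm f))%:E)%E.
Proof. by case=> _ _ n1; rewrite fineK// ge0_fin_numE// L2norm_ge0. Qed.

End L2.

(** * Evolution of quasimodes *)

Section group.
Variables (R : realType) (n : nat).
Implicit Types f g : 'rV[R]_n -> R[i].
Local Notation normc := Normc.normc.
Variables (P : ('rV[R]_n -> R[i]) -> ('rV[R]_n -> R[i]) -> Prop)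
  (U : R -> ('rV[R]_n -> R[i]) -> ('rV[R]_n -> R[i])).

(** With d = U_h f - a f, the group law gives
U_{(k+1)h} f - a^{k+1} f = a (U_{kh} f - a^k f) + U_{kh} d, and U_{kh} is an
isometry, so each step adds at most || d ||. *)
Lemma L2norm_iter_sub f (h : R) (a : R[i]) (k : nat) : unitary_group U ->
  inL2 f -> normc a <= 1 ->
  (L2norm (fun x => U (k%:R * h) f x - a ^+ k * f x)%R <=
    k%:R%:E * L2norm (fun x => U h f x - a * f x)%R)%E.
Proof.
move=> UU Lf a1; have LU t u := @unitary_group_L2 _ _ _ UU t u.
pose d x := U h f x - a * f x.
have Ld : inL2 d by apply: inL2_subZ => //; exact: LU.
elim: k => [|k IH].
  rewrite mul0r mul0e; have L0 := inL2_subZ 1 Lf (LU 0 _ Lf).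
  rewrite (@eq_ae_L2norm _ _ _ (fun x => 0 * f x)).
  - by rewrite L2normZ// Normc.normc0 mul0e.
  - by rewrite expr0.
  - exact: inL2Z.
  - have := unitary_group0 UU Lf; apply: filterS => x ->.
    by rewrite mul1r subrr mul0r.
pose w x := U (k%:R * h) f x - a ^+ k * f x.
have Lw : inL2 w by apply: inL2_subZ => //; exact: LU.
rewrite (@eq_ae_L2norm _ _ _ (fun x => a * w x + U (k%:R * h) d x)); last 3 first.
- by apply: inL2_subZ => //; exact: LU.
- by apply: inL2_lin => //; exact: LU.
- have E1 := unitary_groupD UU (k%:R * h) h Lf.
  have := unitary_group_linear UU (k%:R * h) a Lf Ld.
  have -> : (fun x => a * f x + d x) = U h f.
    by apply/funext => x; rewrite /d addrC subrK.
  apply: filterS2 E1 => x; rewrite /w -natr1 mulrDl mul1r => -> ->.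
  by rewrite exprS; ring.
apply: le_trans (L2normD (inL2Z _ Lw) (LU _ _ Ld)) _.
rewrite (unitary_group_isometry UU)// L2normZ// -natr1 EFinD muleDl ?fin_num_adde_defl//.
rewrite mul1e leeD2r//; first apply: le_trans IH.
  by rewrite -[leRHS]mul1e; apply: lee_wpmul2r; rewrite ?L2norm_ge0// lee_fin.
by have [_ _ ?] := Ld; rewrite ge0_fin_numE// L2norm_ge0.
Qed.

(** One step of the implicit Euler scheme for u' = -icu.  The scalar
a = (1 + ich)^-1 has modulus at most 1 and a = 1 - ich - c^2 h^2 a, whence
U_h f - a f = h ((U_h f - f) / h + ig) + ih (cf - g) + c^2 h^2 a f.
When g = P f the first term is o(h), by definition of the generator. *)
Lemma L2norm_resolvent_step f g (c h : R) : generated_by P U -> P f g -> 0 < h ->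
  exists2 a : R[i], normc a <= 1 &
  (L2norm (fun x => U h f x - a * f x)%R <=
   h%:E * (L2norm (fun x => (h^-1)%:C%C * (U h f x - f x) - (- 'i * g x))%R +
     L2norm (fun x => c%:C%C * f x - g x)%R + (c ^+ 2 * h)%:E * L2norm f))%E.
Proof.
move=> [UU PU] Pfg h0; have [Lf Lg _] := (PU f g).1 Pfg.
have LU t u := @unitary_group_L2 _ _ _ UU t u.
pose ich : R[i] := 'i * (c * h)%:C%C.
have n1 : 1 <= normc (1 + ich).
  rewrite (_ : 1 + ich = (1 +i* (c * h))%C); last first.
    by rewrite /ich -complexiE; apply/eqP; rewrite eq_complex/= ?(mul0r, mul1r, mulr0, subr0, addr0, add0r) !eqxx.
  rewrite /Normc.normc -[leLHS]sqrtr1 ler_sqrt ?addr_ge0 ?sqr_ge0//.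
  by rewrite expr1n lerDl sqr_ge0.
have ne0 : 1 + ich != 0.
  by apply: contraTneq n1 => ->; rewrite Normc.normc0 ler10.
pose a := (1 + ich)^-1.
have a1 : normc a <= 1 by rewrite Normc.normcV invf_le1// (lt_le_trans _ n1).
exists a => //.
set u := U h f; set E := fun x => (h^-1)%:C%C * (u x - f x) - (- 'i * g x).
set D := fun x => c%:C%C * f x - g x.
have LE : inL2 E.
  rewrite (_ : E = fun x => (h^-1)%:C%C * (u x - 1 * f x) - (- 'i) * g x).
    by apply/inL2_subZ/inL2Z/inL2_subZ => //; exact: LU.
  by apply/funext => x; rewrite /E mul1r.
have LD : inL2 D by exact: inL2_Zsub.
have Lh : inL2 (fun x => h%:C%C * E x) by exact: inL2Z.
have Lh2 : inL2 (fun x => (h%:C%C * 'i) * D x) by exact: inL2Z.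
have Lh3 : inL2 (fun x => ((c ^+ 2 * h ^+ 2)%:C%C * a) * f x) by exact: inL2Z.
have -> : (fun x => u x - a * f x) =
   (fun x => (h%:C%C * E x + (h%:C%C * 'i) * D x) + ((c ^+ 2 * h ^+ 2)%:C%C * a) * f x).
  apply/funext => x; rewrite /E /D.
  have hV : h%:C%C * (h^-1)%:C%C = 1 :> R[i].
    by rewrite -rmorphM/= divff ?gt_eqF.
  have ii : 'i * 'i = -1 :> R[i] by rewrite -expr2 sqrCi.
  have aE : a = 1 - ich * a.
    have : (1 + ich) * a = 1 by rewrite /a mulfV.
    by rewrite mulrDl mul1r => /(canRL (addrK _)).
  (* iterate a = 1 - ich a once *)
  have aE2 : a = 1 - ich + ich * ich * a by rewrite {1}aE {1}aE; ring.
  have ich2 : ich * ich = - (c ^+ 2 * h ^+ 2)%:C%C.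
    by rewrite /ich mulrACA ii -rmorphM/= mulN1r -exprMn expr2.
  have rm : (c * h)%:C%C = c%:C%C * h%:C%C :> R[i] by rewrite rmorphM.
  have -> : h%:C%C * ((h^-1)%:C%C * (u x - f x) - (- 'i) * g x) =
      (u x - f x) + h%:C%C * 'i * g x.
    by rewrite mulrBr mulrA hV; ring.
  rewrite {1}aE2 ich2 /ich rm; move: (c%:C%C) (h%:C%C) (_%:C%C) => c' h' ch2.
  ring.
apply: le_trans (L2normD (inL2D Lh Lh2) Lh3) _.
apply: le_trans (leeD2r _ (L2normD Lh Lh2)) _.
rewrite !L2normZ// !normc_real !Normc.normcM normc_i !normc_real mulr1.
have cn : 0 <= c ^+ 2 * h ^+ 2 by rewrite mulr_ge0 ?sqr_ge0.
rewrite (ger0_norm (ltW h0)) (ger0_norm cn).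
rewrite (L2norm_fin Lf) (L2norm_fin LE) (L2norm_fin LD) -!EFinM -!EFinD lee_fin.
rewrite !mulrDr lerD2l mulrA (_ : h * (c ^+ 2 * h) = c ^+ 2 * h ^+ 2); last by ring.
apply: ler_wpM2r; first by rewrite fine_ge0 ?L2norm_ge0.
by rewrite ler_piMr.
Qed.

(** Apply the Euler step N times with h = t / N.  The terms other than
t || cf - g || tend to 0 as N grows; z is the N-th power of the Euler factor. *)
Lemma quasimode_evolution f g (c t e : R) : generated_by P U -> P f g ->
  0 <= t -> 0 < e ->
  exists z : R[i],
  (L2norm (fun x => U t f x - z * f x)%R <=
     t%:E * L2norm (fun x => c%:C%C * f x - g x)%R + e%:E)%E.
Proof.
move=> UP Pfg; have [UU PU] := UP; have [Lf Lg lim0] := (PU f g).1 Pfg.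
rewrite le_eqVlt => /predU1P[<-|t0] e0.
  exists (1 ^+ 0); have := @L2norm_iter_sub f 0 1 0 UU Lf.
  rewrite mul0r mul0e Normc.normc1 => /(_ (lexx _)) /le_trans; apply.
  by rewrite mul0e add0e lee_fin ltW.
set F := fine (L2norm f); have F0 : 0 <= F by rewrite fine_ge0 ?L2norm_ge0.
have e'0 : 0 < e / 2 / t by rewrite !divr_gt0.
have /lim0 : nbhs (0%E : \bar R) [set y | (y < (e / 2 / t)%:E)%E].
  apply: open_nbhs_nbhs; split; first exact: open_ereal_lt_ereal.
  by rewrite /= lte_fin.
move=> [d /= d0 hd].
(* t / N < d makes the difference quotient e / 2t-close to the generator, and
   the second summand makes the quadratic error c^2 t (t / N) || f || at most
   e / 2 *)
pose N := (Num.truncn (t / d + t * (t * c ^+ 2 * F) / (e / 2))).+1.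
have N0 : 0 < N%:R :> R by rewrite ltr0n.
have NB : t / d + t * (t * c ^+ 2 * F) / (e / 2) < N%:R by rewrite truncnS_gt.
have Nd : t / d < N%:R.
  apply: le_lt_trans NB; rewrite lerDl; apply: divr_ge0; last by apply/ltW/divr_gt0.
  by rewrite !(sqr_ge0, mulr_ge0, ltW t0).
have Ne : t * (t * c ^+ 2 * F) / (e / 2) < N%:R.
  by apply: le_lt_trans NB; rewrite lerDr divr_ge0 ?ltW.
pose h := t / N%:R; have h0 : 0 < h by rewrite divr_gt0.
have hd' : h < d by rewrite ltr_pdivrMr// mulrC -ltr_pdivrMr.
have he : t * (c ^+ 2 * h * F) <= e / 2.
  rewrite (_ : _ * _ = t * (t * c ^+ 2 * F) / N%:R); last by rewrite /h; ring.
  by rewrite ler_pdivrMr// [leRHS]mulrC -ler_pdivrMr ?divr_gt0// ltW.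
have [a a1 step] := L2norm_resolvent_step c UP Pfg h0.
exists (a ^+ N); have Nh : N%:R * h = t by rewrite /h mulrC divfK ?gt_eqF.
have := @L2norm_iter_sub f h a N UU Lf a1; rewrite Nh => /le_trans; apply.
have LD : inL2 (fun x => c%:C%C * f x - g x) by exact: inL2_Zsub.
apply: (@le_trans _ _ (N%:R%:E * (h%:E * ((e / 2 / t)%:E + L2norm (fun x => c%:C%C * f x - g x)%R + (c ^+ 2 * h)%:E * L2norm f)))%E).
  rewrite lee_wpmul2l ?lee_fin//; apply: le_trans step _.
  rewrite lee_wpmul2l ?lee_fin ?(ltW h0)//; do 2 apply: leeD2r.
  apply/ltW/hd => /=; last by rewrite gt_eqF.
  by rewrite sub0r normrN gtr0_norm.
rewrite (L2norm_fin LD) (L2norm_fin Lf) -/F -!EFinM -!EFinD lee_fin mulrA Nh.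
set D := fine _; rewrite !mulrDr [t * (_ / t)]mulrC divfK ?gt_eqF//.
by rewrite addrAC [leRHS]addrC lerD2r {2}(splitr e) lerD2l.
Qed.
End group.

(** * A smooth bump function on the line *)

Section flat.
Variable R : realType.
Implicit Types (p q : {poly R}) (x y : R).

(** The case p = 1 is the classical flat function exp(-1/x).  The polynomial
makes the family stable under differentiation. *)
Definition flat p x : R := if 0 < x then p.[x^-1] * expR (- x^-1) else 0.

(** y^k <= k! exp y for each monomial. *)
Lemma horner_le_expR p : exists2 K : R, 0 <= K &
  forall y, 0 <= y -> `|p.[y]| <= K * expR y.
Proof.
exists (\sum_(i < size p) `|p`_i| * (i`!)%:R).
  by apply: sumr_ge0 => i _; rewrite mulr_ge0.
move=> y y0; rewrite horner_coef (le_trans (ler_norm_sum _ _ _))// mulr_suml.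
apply: ler_sum => i _; rewrite normrM normrX (ger0_norm y0) -mulrA ler_wpM2l//.
case: (nat_of_ord i) => [|k]; first by rewrite expr0 fact0 mul1r -expR0 ler_expR.
have kf : 0 < k.+1`!%:R :> R by rewrite ltr0n fact_gt0.
rewrite mulrC -ler_pdivrMr//; apply: le_trans (expR_ge1Dxn k y0).
by rewrite lerDr.
Qed.

Lemma flat_bounded p : exists2 K : R, 0 <= K & forall x, `|flat p x| <= K.
Proof.
have [K K0 Kp] := horner_le_expR p; exists K => // x; rewrite /flat.
case: ifPn => [x0|_]; last by rewrite normr0.
rewrite normrM (ger0_norm (expR_ge0 _)) expRN ler_pdivrMr ?expR_gt0//.
by apply: Kp; rewrite invr_ge0 ltW.
Qed.

(** Dividing by x stays in the family; together with the uniform bound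
flat_bounded this gives continuity and differentiability at 0 for free. *)
Lemma flat_mulX p x : flat p x = flat (p * 'X) x * x.
Proof.
rewrite /flat; case: ifPn => [x0|_]; last by rewrite mul0r.
by rewrite hornerMX mulrAC divfK ?gt_eqF.
Qed.

Lemma flat0 p : flat p 0 = 0.
Proof. by rewrite /flat ltxx. Qed.

Lemma flatN p x : flat (- p) x = - flat p x.
Proof. by rewrite /flat; case: ifP; rewrite ?oppr0// hornerN mulNr. Qed.

Lemma flat_continuous0 p : {for 0, continuous (flat p)}.
Proof.
have [K K0 Kp] := flat_bounded (p * 'X).
apply/cvgrPdist_le => e e0; rewrite flat0.
have K1 : 0 < K + 1 by rewrite ltr_wpDl.
exists (e / (K + 1)) => [|x /=]; first exact: divr_gt0.
rewrite !sub0r !normrN => /ltW xe; rewrite flat_mulX normrM.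
apply: (@le_trans _ _ ((K + 1) * `|x|)); last by rewrite mulrC -ler_pdivlMr.
by rewrite ler_wpM2r// (le_trans (Kp _))// lerDl.
Qed.

(** For x > 0 this is the product rule: the derivative of p(1/x) exp(-1/x) is
(p - p')(1/x) x^-2 exp(-1/x).  At 0, Caratheodory's criterion applies to the
factorization flat p x = flat (p * 'X) x * x. *)
Lemma is_derive_flat p x :
  is_derive x 1 (flat p) (flat ((p - p^`()) * 'X^2) x).
Proof.
have [x0|x0|->] := ltgtP x 0.
- apply: (@near_eq_is_derive _ _ _ (cst 0)) => //.
    near=> y; rewrite /flat ltNge (_ : y <= 0)//; near: y.
    exact: lt_le_nbhsl.
  rewrite /flat ltNge (ltW x0)/=; exact: is_derive_cst.
- apply: (@near_eq_is_derive _ _ _ (fun y => p.[y^-1] * expR (- y^-1))) => //.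
    by near=> y; rewrite /flat (_ : 0 < y)//; near: y; exact: lt_nbhsr.
  have dV : is_derive x 1 (fun y : R => y^-1) (- x ^- 2).
    apply: is_derive_eq (is_deriveV _ (is_derive_id _ _)) _; first by rewrite gt_eqF.
    by rewrite scaler1.
  have dN : is_derive x 1 (fun y : R => - y^-1) (x ^- 2).
    by apply: is_derive_eq (is_deriveN dV) _; rewrite opprK.
  have dp := @is_derive1_comp _ (horner p) (fun y => y^-1) _ _ _ (is_derive_poly p x^-1) dV.
  have de := @is_derive1_comp _ expR (fun y => - y^-1) _ _ _ (is_derive_expR (- x^-1)) dN.
  apply: is_derive_eq (is_deriveM dp de) _.
  rewrite /flat x0 hornerM hornerD hornerN hornerXn exprVn /=.
  by rewrite /GRing.scale/=; ring.
- rewrite flat0; apply/is_derive1_caratheodory; exists (flat (p * 'X)).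
  split; last by rewrite flat0.
    by move=> z; rewrite flat0 !subr0 flat_mulX.
  exact: flat_continuous0.
Unshelve. all: by end_near. Qed.

End flat.

Section bump.
Variable R : realType.

(** The span of the products of a flat function at -1 and a reflected one at 1:
a class of functions supported in [-1, 1] that is closed under differentiation,
so that all derivatives of its members exist and are bounded. *)
Inductive bumplike : (R -> R) -> Prop :=
| bumplike_flat p q : bumplike (fun x => flat p (1 + x) * flat q (1 - x))
| bumplikeD f g : bumplike f -> bumplike g -> bumplike (fun x => f x + g x).

Lemma is_derive_bumplike f : bumplike f ->
  exists2 g, bumplike g & forall x : R, is_derive x 1 f (g x).
Proof.
elim=> [p q|f1 f2 _ [g1 b1 d1] _ [g2 b2 d2]]; last first.
  exists (fun x => g1 x + g2 x); first exact: bumplikeD.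
  by move=> x; exact: is_deriveD.
exists (fun x => flat ((p - p^`()) * 'X^2) (1 + x) * flat q (1 - x) +
                 flat p (1 + x) * flat (- ((q - q^`()) * 'X^2)) (1 - x)).
  by apply: bumplikeD; exact: bumplike_flat.
move=> x.
have d1 : is_derive x 1 (fun y : R => 1 + y) (1 : R).
  by apply: is_derive_eq (is_deriveD (is_derive_cst _ _ _) (is_derive_id _ _)) _; rewrite add0r.
have d2 : is_derive x 1 (fun y : R => 1 - y) (- 1 : R).
  by apply: is_derive_eq (is_deriveB (is_derive_cst _ _ _) (is_derive_id _ _)) _; rewrite sub0r.
have dp := @is_derive1_comp _ (flat p) (fun y => 1 + y) _ _ _ (is_derive_flat p (1 + x)) d1.
have dq := @is_derive1_comp _ (flat q) (fun y => 1 - y) _ _ _ (is_derive_flat q (1 - x)) d2.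
apply: is_derive_eq (is_deriveM dp dq) _.
rewrite /GRing.scale/= flatN; ring.
Qed.

Lemma bumplike_derive1n f k : bumplike f -> bumplike (f^`(k)%classic) /\
  forall x : R, derivable (f^`(k)%classic) x 1.
Proof.
move=> bf; suff bk : bumplike (f^`(k)%classic).
  by split => // x; have [g _ /(_ x) []] := is_derive_bumplike bk.
elim: k => [|k IH]; first by rewrite derive1n0.
have [g bg dg] := is_derive_bumplike IH; rewrite derive1nS.
rewrite (_ : _^`()%classic = g)//; apply/funext => x; rewrite derive1E.
by have [_ ->] := dg x.
Qed.

Lemma bumplike_support f x : bumplike f -> 1 <= `|x| -> f x = 0.
Proof.
move=> bf x1; elim: bf => [p q|f1 f2 _ f10 _ f20]; last by rewrite f10 f20 addr0.
rewrite /flat; case: ifPn => [x0|]; last by rewrite mul0r.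
case: ifPn => [x0'|]; last by rewrite mulr0.
by move: x1; rewrite leNgt ltr_norml; lra.
Qed.

Lemma bumplike_bounded f : bumplike f -> exists2 M, 0 <= M & forall x, `|f x| <= M.
Proof.
elim=> [p q|f1 f2 _ [M1 M10 f1M] _ [M2 M20 f2M]]; last first.
  exists (M1 + M2); first exact: addr_ge0.
  by move=> x; rewrite (le_trans (ler_normD _ _))// lerD.
have [M1 M10 f1M] := flat_bounded p.
have [M2 M20 f2M] := flat_bounded q.
exists (M1 * M2); first exact: mulr_ge0.
by move=> x; rewrite normrM ler_pM.
Qed.

Definition bump (x : R) : R := flat 1 (1 + x) * flat 1 (1 - x).

Lemma bumplike_bump : bumplike bump.
Proof. exact: bumplike_flat. Qed.

Lemma bump_ge x : `|x| <= 2^-1 -> expR (- 4) <= bump x.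
Proof.
rewrite ler_norml => /andP[x1 x2].
have flat1 (y : R) : 2^-1 <= y -> expR (- 2) <= flat 1 y.
  move=> y2; have y0 : 0 < y by lra.
  rewrite /flat y0 hornerC mul1r ler_expR lerN2 -[leRHS]invrK lef_pV2//.
  by rewrite posrE.
rewrite (_ : - 4 = - 2 + - 2 :> R); last by ring.
rewrite expRD; apply: ler_pM; rewrite ?expR_ge0//; apply: flat1; lra.
Qed.

Lemma derive1n_affine (f : R -> R) (a b : R) k :
  (forall j (x : R), derivable (f^`(j)%classic) x 1) ->
  (fun x => f (b * (x - a)))^`(k)%classic = (fun x => b ^+ k * (f^`(k)%classic) (b * (x - a))).
Proof.
move=> df; elim: k => [|k IH].
  by rewrite !derive1n0; apply/funext => x; rewrite expr0 mul1r.
rewrite derive1nS IH; apply/funext => x; rewrite derive1E.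
have d1 : is_derive x 1 (fun y : R => b * (y - a)) b.
  apply: is_derive_eq (is_deriveZ b (is_deriveB (is_derive_id _ _) (is_derive_cst _ _ _))) _.
  by rewrite subr0 /GRing.scale/= mulr1.
have dk := @is_derive1_comp _ (f^`(k)%classic) (fun y => b * (y - a)) _ _ _ (derivableP (df k (b * (x - a)))) d1.
have [_ ->] := is_deriveZ (b ^+ k) dk.
by rewrite -derive1E -derive1nS /GRing.scale/= exprSr mulrA mulrAC.
Qed.
End bump.

(** * The Euclidean norm *)

Section enorm_theory.
Variables (R : realType) (n : nat).
Implicit Types x y : 'rV[R]_n.

Lemma enorm_ge0 x : 0 <= enorm x.
Proof. exact: sqrtr_ge0. Qed.

Lemma enorm_sqr x : enorm x ^+ 2 = \sum_(i < n) x ord0 i ^+ 2.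
Proof. by rewrite sqr_sqrtr// sumr_ge0// => i _; exact: sqr_ge0. Qed.

Lemma enormZ (a : R) x : enorm (a *: x) = `|a| * enorm x.
Proof.
rewrite /enorm; under eq_bigr do rewrite mxE exprMn.
by rewrite -mulr_sumr sqrtrM ?sqr_ge0// sqrtr_sqr.
Qed.

Lemma enorm_le_sum x : enorm x <= \sum_(i < n) `|x ord0 i|.
Proof.
have s0 : 0 <= \sum_(i < n) `|x ord0 i| by exact: sumr_ge0.
rewrite /enorm -(ger0_norm s0) -sqrtr_sqr ler_wsqrtr//.
suff [] : 0 <= \sum_(i < n) `|x ord0 i| /\
  \sum_(i < n) x ord0 i ^+ 2 <= (\sum_(i < n) `|x ord0 i|) ^+ 2 by [].
elim/big_ind2 : _ => [|u v w z [u0 vu] [w0 zw]|i _].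
- by rewrite expr0n.
- split; first exact: addr_ge0.
  rewrite sqrrD [leRHS]addrAC; apply: (le_trans (lerD vu zw)).
  by rewrite lerDl mulrn_wge0 ?mulr_ge0.
- by rewrite normr_ge0 real_normK ?num_real.
Qed.

Lemma ler_coord_enorm x i : `|x ord0 i| <= enorm x.
Proof.
rewrite -sqrtr_sqr /enorm ler_wsqrtr// (bigD1 i)//= lerDl.
by apply: sumr_ge0 => j _; exact: sqr_ge0.
Qed.

Lemma enormN x : enorm (- x) = enorm x.
Proof. by rewrite -scaleN1r enormZ normrN1 mul1r. Qed.

(** Cauchy-Schwarz, from the nonnegativity of || |y| x - |x| y ||^2. *)
Lemma ler_dot_enorm x y : \sum_(i < n) x ord0 i * y ord0 i <= enorm x * enorm y.
Proof.
have [x0|x0] := leP (enorm x) 0.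
  rewrite big1 ?mulr_ge0 ?enorm_ge0// => i _.
  have := le_trans (ler_coord_enorm x i) x0.
  by rewrite normr_le0 => /eqP ->; rewrite mul0r.
have [y0|y0] := leP (enorm y) 0.
  rewrite big1 ?mulr_ge0 ?enorm_ge0// => i _.
  have := le_trans (ler_coord_enorm y i) y0.
  by rewrite normr_le0 => /eqP ->; rewrite mulr0.
set a := enorm x in x0 *; set b := enorm y in y0 *.
have : 0 <= \sum_(i < n) (b * x ord0 i - a * y ord0 i) ^+ 2.
  by apply: sumr_ge0 => i _; exact: sqr_ge0.
rewrite (_ : \sum_(i < n) _ = (2 * a * b) * (a * b - \sum_(i < n) x ord0 i * y ord0 i)).
  by rewrite pmulr_rge0 ?mulr_gt0// subr_ge0.
under eq_bigr => i _.
  rewrite (_ : _ ^+ 2 = b ^+ 2 * x ord0 i ^+ 2 + (- (2 * a * b) * (x ord0 i * y ord0 i) + a ^+ 2 * y ord0 i ^+ 2)); last by ring.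
  over.
rewrite big_split/= big_split/= -!mulr_sumr -!enorm_sqr -/a -/b; ring.
Qed.

Lemma ler_enormD x y : enorm (x + y) <= enorm x + enorm y.
Proof.
rewrite -(@ler_pXn2r _ 2)// ?nnegrE ?addr_ge0 ?enorm_ge0//.
rewrite enorm_sqr sqrrD !enorm_sqr.
under eq_bigr do rewrite mxE sqrrD -mulr_natr.
rewrite big_split/= big_split/= lerD2r lerD2l -mulr_suml mulr_natr.
by rewrite lerMn2r ler_dot_enorm orbT.
Qed.

End enorm_theory.

(** * Tensor products of smooth functions *)

Section tensor.
Variables (R : realType) (n : nat).
Implicit Types (g : 'I_n -> R -> R) (x : 'rV[R]_n).

Definition smooth1 (f : R -> R) := forall k (x : R), derivable (f^`(k)%classic) x 1.

(** The scalar factor lets the zero function and scalar multiples be treated as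
tensor products too. *)
Definition tensor (a : R) g x : R := a * \prod_(i < n) g i (x ord0 i).

Lemma differentiable_tensor a g x :
  (forall i (y : R), derivable (g i) y 1) -> differentiable (tensor a g) x.
Proof.
move=> dg; rewrite /tensor.
apply: differentiableM; first exact: differentiable_cst.
have dc i : differentiable (fun y : 'rV[R]_n => g i (y ord0 i)) x.
  apply: (@differentiable_comp _ _ _ _ (fun y : 'rV[R]_n => y ord0 i) (g i)).
    exact: differentiable_coord.
  exact/derivable1_diffP.
elim: (index_enum _) => [|i s IH].
  by under eq_fun do rewrite big_nil; exact: differentiable_cst.
by under eq_fun do rewrite big_cons; exact: differentiableM.
Qed.

(** Along the j-th axis only the j-th factor varies, so the difference quotient
is that of c * g j for the constant c below. *)
Lemma partial_tensor a g j :
  (forall y : R, derivable (g j) y 1) ->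
  partial j (tensor a g) =
  tensor a (fun i => if i == j then (g i)^`()%classic else g i).
Proof.
move=> dg; apply/funext => x.
pose c := a * \prod_(i < n | i != j) g i (x ord0 i).
transitivity ('D_1 (fun y : R => c * g j y) (x ord0 j)).
  rewrite /partial /derive.
  rewrite (_ : (fun h : R => h^-1 *: ((tensor a g \o shift x) (h *: delta_mx ord0 j) - tensor a g x)) =
     (fun h => h^-1 *: (((fun y : R => c * g j y) \o shift (x ord0 j)) (h *: 1) - c * g j (x ord0 j))))//.
  apply/funext => h /=.
  congr (_ *: (_ - _)); rewrite /tensor (bigD1 j)//= /c.
    rewrite !mxE !eqxx/= mulrCA mulrC; congr (_ * _ * _).
    by apply: eq_bigr => i /negPf ij; rewrite !mxE ij andbF mulr0 add0r.
  by rewrite mulrCA mulrC.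
have [_ ->] := is_deriveZ c (derivableP (dg (x ord0 j))).
rewrite /GRing.scale/= /tensor (bigD1 j)//= eqxx derive1E /c -mulrA [X in a * X = _]mulrC.
congr (_ * (_ * _)).
by apply: eq_bigr => i /negPf ->.
Qed.

Lemma foldr_partial_tensor a g (s : seq 'I_n) : (forall i, smooth1 (g i)) ->
  foldr (@partial R n) (tensor a g) s =
  tensor a (fun i => (g i)^`(count_mem i s)%classic).
Proof.
move=> sg; elim: s => [//|j s IH] /=; rewrite IH partial_tensor; last exact: sg.
congr tensor; apply/funext => i; rewrite [j == i]eq_sym.
by case: eqP => [->|_]; rewrite ?add1n ?derive1nS.
Qed.

Lemma smooth_tensor a g : (forall i, smooth1 (g i)) -> smooth (tensor a g).
Proof.
move=> sg s x; rewrite foldr_partial_tensor//.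
by apply: differentiable_tensor => i y; exact: sg.
Qed.

Lemma laplacian_tensor a g x : (forall i, smooth1 (g i)) ->
  laplacian (tensor a g) x = \sum_(j < n)
    tensor a (fun i => if i == j then (g i)^`(2)%classic else g i) x.
Proof.
move=> sg; apply: eq_bigr => j _.
have := @foldr_partial_tensor a g [:: j; j] sg; rewrite /= => ->.
congr (tensor _ _ _); apply/funext => i; rewrite eq_sym.
by case: eqP.
Qed.

End tensor.

(** * Cutoffs on large cubes *)

Section cutoff.
Variables (R : realType) (n : nat).
Local Notation normc := Normc.normc.

Definition box (a : 'rV[R]_n) (L : R) : set 'rV[R]_n :=
  [set x | forall i, ball (a ord0 i) L (x ord0 i)].

Definition cutoff (a : 'rV[R]_n) (L : R) : 'rV[R]_n -> R :=
  tensor 1 (fun i y => bump (L^-1 * (y - a ord0 i))).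

Lemma smooth1_cutoff (a : 'rV[R]_n) (L : R) i :
  smooth1 (fun y => bump (L^-1 * (y - a ord0 i))).
Proof.
have sb k (x : R) : derivable ((@bump R)^`(k)%classic) x 1.
  by have [_] := bumplike_derive1n k (bumplike_bump R); exact.
move=> k x; rewrite derive1n_affine//.
apply: derivableM => //.
apply/derivable1_diffP.
apply: (@differentiable_comp _ _ _ _ (fun y : R => L^-1 * (y - a ord0 i)) ((@bump R)^`(k)%classic)).
  by apply: differentiableM => //; apply: differentiableB.
exact/derivable1_diffP.
Qed.

Lemma cutoffE (a : 'rV[R]_n) L x :
  cutoff a L x = \prod_(i < n) bump (L^-1 * (x ord0 i - a ord0 i)).
Proof. by rewrite /cutoff /tensor mul1r. Qed.

Lemma nbox (a : 'rV[R]_n) L x : 0 < L -> ~ box a L x ->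
  exists i, 1 <= `|L^-1 * (x ord0 i - a ord0 i)|.
Proof.
rewrite /box /= => L0 /existsNP[i nb]; exists i.
rewrite normrM gtr0_norm ?invr_gt0// mulrC ler_pdivlMr// mul1r distrC.
by rewrite leNgt; apply/negP.
Qed.

Lemma cutoff_out (a : 'rV[R]_n) L x : 0 < L -> ~ box a L x -> cutoff a L x = 0.
Proof.
move=> L0 /nbox - /(_ L0)[i xi]; rewrite cutoffE (bigD1 i)//=.
by rewrite (bumplike_support (bumplike_bump R) xi) mul0r.
Qed.

Lemma prodD1 (F : 'I_n -> R) j :
  \prod_(i < n) F i = F j * \prod_(i < n | i != j) F i.
Proof. by rewrite (bigD1 j). Qed.

Lemma laplacian_cutoff_out (a : 'rV[R]_n) L x : 0 < L -> ~ box a L x ->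
  laplacian (cutoff a L) x = 0.
Proof.
move=> L0 /nbox - /(_ L0)[i xi].
rewrite laplacian_tensor; last exact: smooth1_cutoff.
apply: big1 => j _; rewrite /tensor mul1r (prodD1 _ i) [X in X * _](_ : _ = 0) ?mul0r//.
have bs k := bumplike_support (bumplike_derive1n k (bumplike_bump R)).1 xi.
case: (i =P j) => _; last exact: (bs 0%N).
rewrite derive1n_affine; last by move=> k y; have [] := bumplike_derive1n k (bumplike_bump R).
by rewrite bs mulr0.
Qed.

(** Each second derivative of the rescaled bump brings a factor L^-2, and every
term of the Laplacian is a product of n bounded factors.  The bound K depends
on the dimension only. *)
Lemma cutoff_bounds : exists2 K : R, 0 <= K & forall (a : 'rV[R]_n) L x, 0 < L ->
  `|cutoff a L x| <= K /\ `|laplacian (cutoff a L) x| <= K / L ^+ 2.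
Proof.
have [M0 M00 hM0] := bumplike_bounded (bumplike_bump R).
have [M2 M20 hM2] := bumplike_bounded (bumplike_derive1n 2 (bumplike_bump R)).1.
pose M := 1 + M0 + M2.
have M1 : 1 <= M by rewrite /M -addrA lerDl addr_ge0.
have M01 : M0 <= M by rewrite /M; lra.
have M21 : M2 <= M by rewrite /M; lra.
have Mn : 0 <= M ^+ n by rewrite exprn_ge0// (le_trans ler01).
exists (n.+1%:R * M ^+ n) => [|a L x L0]; first by rewrite mulr_ge0.
have prodM (u : 'I_n -> R) : (forall i, `|u i| <= M) -> `|\prod_i u i| <= M ^+ n.
  move=> uM; rewrite normr_prod -[n in _ ^+ n]card_ord -prodr_const.
  by apply: ler_prod => i _; rewrite normr_ge0 uM.
split.
  rewrite cutoffE; apply: (@le_trans _ _ (M ^+ n)).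
    by apply: prodM => i; exact: le_trans M01.
  by rewrite ler_peMl// ler1n.
rewrite laplacian_tensor; last exact: smooth1_cutoff.
apply: le_trans (ler_norm_sum _ _ _) _.
apply: (@le_trans _ _ (\sum_(j < n) M ^+ n / L ^+ 2)); last first.
  rewrite sumr_const card_ord -[leLHS]mulr_natl mulrA ler_wpM2r//.
    by rewrite invr_ge0 exprn_ge0// ltW.
  by rewrite ler_wpM2r// ler_nat.
apply: ler_sum => j _.
pose u i := if i == j then (@bump R)^`(2)%classic (L^-1 * (x ord0 i - a ord0 i))
  else bump (L^-1 * (x ord0 i - a ord0 i)).
rewrite (_ : tensor _ _ _ = L ^- 2 * \prod_i u i).
  have L2 : 0 <= L ^- 2 by rewrite invr_ge0 exprn_ge0// ltW.
  rewrite normrM (ger0_norm L2) mulrC ler_wpM2r//.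
  by apply: prodM => i; rewrite /u; case: ifP => _; [exact: le_trans M21|exact: le_trans M01].
rewrite /tensor mul1r (prodD1 _ j) [in RHS](prodD1 _ j) /u eqxx mulrA.
rewrite derive1n_affine; last by move=> k y; have [] := bumplike_derive1n k (bumplike_bump R).
rewrite exprVn; congr (_ * _).
by apply: eq_bigr => i /negPf ->.
Qed.

Lemma cutoff_ge (a : 'rV[R]_n) L x : 0 < L -> box a (L / 2) x ->
  expR (- 4) ^+ n <= cutoff a L x.
Proof.
move=> L0 bx; rewrite cutoffE -[n in _ ^+ n]card_ord -prodr_const.
apply: ler_prod => i _; rewrite expR_ge0/=; apply: bump_ge.
rewrite normrM gtr0_norm ?invr_gt0// mulrC ler_pdivrMr// distrC mulrC.
exact: (ltW (bx i)).
Qed.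

Lemma measurable_box (a : 'rV[R]_n) (L : R) : 0 < L -> measurable (box a L).
Proof.
move=> L0; apply: open_measurable_rV; rewrite (_ : box a L = ball a L).
  exact: ball_open.
apply/seteqP; split => x /= xa; last by move=> i; exact: xa.2.
by split => // i j; rewrite (ord1 i); exact: xa.
Qed.

Lemma lebesgue_rV_cube (a : 'rV[R]_n) (L : R) : 0 <= L ->
  lebesgue_rV R n (box a L) = ((2 * L) ^+ n)%:E.
Proof.
move=> L0.
rewrite (lebesgue_rV_box (B := fun i => ball (a ord0 i) L)); last first.
  by move=> i; exact: measurable_ball.
under eq_bigr do rewrite lebesgue_measure_ball//.
by rewrite prodEFin prodr_const card_ord mulr_natl.
Qed.

Lemma L2norm_sqr_le (f : 'rV[R]_n -> R[i]) (a : 'rV[R]_n) (L M : R) :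
  0 < L -> 0 <= M ->
  (forall x, box a L x -> normc (f x) <= M) ->
  (forall x, ~ box a L x -> f x = 0) ->
  (L2norm f ^+ 2 <= (M ^+ 2 * (2 * L) ^+ n)%:E)%E.
Proof.
move=> L0 M0 fM fo; rewrite L2norm_sqr EFinM -(lebesgue_rV_cube a (ltW L0)) -[box a L]setIT.
rewrite -integral_indic//; last exact: measurable_box.
rewrite -ge0_integralZl//=; last 2 first.
- by apply/measurable_EFinP/measurable_indic; exact: measurable_box.
- by rewrite lee_fin sqr_ge0.
apply: ge0_le_integralW => x _; rewrite -?EFinM lee_fin ?sqr_ge0//.
rewrite indicE; have [bx|nbx] := pselect (box a L x).
  by rewrite mem_set//= mulr1 lerXn2r ?nnegrE ?normc_ge0// fM.
by rewrite memNset//= mulr0 fo// Normc.normc0 expr0n.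
Qed.

Lemma L2norm_sqr_ge (f : 'rV[R]_n -> R[i]) (a : 'rV[R]_n) (L m : R) :
  0 < L -> 0 <= m ->
  (forall x, box a L x -> m <= normc (f x)) ->
  ((m ^+ 2 * (2 * L) ^+ n)%:E <= L2norm f ^+ 2)%E.
Proof.
move=> L0 m0 fm; rewrite L2norm_sqr EFinM -(lebesgue_rV_cube a (ltW L0)) -[box a L]setIT.
rewrite -integral_indic//; last exact: measurable_box.
rewrite -ge0_integralZl//=; last 2 first.
- by apply/measurable_EFinP/measurable_indic; exact: measurable_box.
- by rewrite lee_fin sqr_ge0.
apply: ge0_le_integralW => x _; rewrite -?EFinM lee_fin ?mulr_ge0 ?sqr_ge0//.
rewrite indicE; have [bx|nbx] := pselect (box a L x).
  by rewrite mem_set//= mulr1 lerXn2r ?nnegrE ?normc_ge0// fm.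
by rewrite memNset//= mulr0 sqr_ge0.
Qed.

Lemma scaled_cutoffE (k : R) (a : 'rV[R]_n) (L : R) :
  (fun x => k * cutoff a L x) = tensor k (fun i y => bump (L^-1 * (y - a ord0 i))).
Proof. by apply/funext => x; rewrite cutoffE. Qed.

Lemma test_function_cutoff (k : R) (a : 'rV[R]_n) (L : R) : 0 < L ->
  test_function (fun x => (k * cutoff a L x)%:C%C).
Proof.
move=> L0; split.
- rewrite (_ : re_part _ = fun x => k * cutoff a L x)// scaled_cutoffE.
  by apply: smooth_tensor => i; exact: smooth1_cutoff.
- rewrite (_ : im_part _ = fun x => 0 * cutoff a L x); last first.
    by apply/funext => x; rewrite mul0r.
  by rewrite scaled_cutoffE; apply: smooth_tensor => i; exact: smooth1_cutoff.
- exists (\sum_(i < n) (`|a ord0 i| + L)) => x.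
  have [bx|nbx] := pselect (box a L x); last by rewrite cutoff_out// mulr0.
  rewrite ltNge (le_trans (enorm_le_sum x))//; apply: ler_sum => i _.
  rewrite -[x in `|x|](subrK (a ord0 i)) addrC (le_trans (ler_normD _ _))//.
  by rewrite lerD2l distrC ltW//; exact: bx.
Qed.

Lemma laplacian_scaled_cutoff (k : R) (a : 'rV[R]_n) (L : R) x :
  laplacian (fun x => k * cutoff a L x) x = k * laplacian (cutoff a L) x.
Proof.
rewrite scaled_cutoffE !laplacian_tensor; do ?exact: smooth1_cutoff.
by rewrite mulr_sumr; apply: eq_bigr => j _; rewrite /tensor mul1r.
Qed.

Lemma schrodinger_cutoff (V : 'rV[R]_n -> R) (k : R) (a : 'rV[R]_n) (L : R) x :
  schrodinger V (fun x => (k * cutoff a L x)%:C%C) x =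
  (k * (- laplacian (cutoff a L) x + V x * cutoff a L x))%:C%C.
Proof.
rewrite /schrodinger (_ : re_part _ = fun x => k * cutoff a L x)//.
rewrite (_ : im_part _ = fun x => 0 * cutoff a L x); last first.
  by apply/funext => y; rewrite mul0r.
rewrite !laplacian_scaled_cutoff mul0r.
rewrite -[(_ +i* 0)%C]/(k * laplacian (cutoff a L) x)%:C%C.
by rewrite -rmorphN -rmorphM -rmorphD; congr (_ %:C)%C; ring.
Qed.

Lemma L2norm_cutoff_gt0 (a : 'rV[R]_n) (L : R) : 0 < L ->
  (0 < L2norm (fun x => (cutoff a L x)%:C%C))%E.
Proof.
move=> L0; rewrite lt0e L2norm_ge0 andbT; apply/eqP => f0.
have := @L2norm_sqr_ge (fun x => (cutoff a L x)%:C%C) a (L / 2) (expR (- 4) ^+ n).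
rewrite f0 divr_gt0// exprn_ge0 ?expR_ge0// => /(_ isT isT).
have H x : box a (L / 2) x -> expR (- 4) ^+ n <= normc (cutoff a L x)%:C%C.
  by move=> bx; rewrite normc_real; apply: le_trans (ler_norm _); exact: cutoff_ge.
move=> /(_ H); rewrite expe2 mule0 lee_fin leNgt => /negP; apply.
by rewrite mulr_gt0// exprn_gt0// ?exprn_gt0 ?expR_gt0// mulr_gt0// divr_gt0.
Qed.

(** The function (c - P) f is bounded by M (L^-2 + e) on the cube of half-side L
and vanishes outside, while f is at least exp(-4)^n on the cube of half-side
L / 2.  The two cubes have proportional volumes, so the ratio of the L^2 norms
is controlled by the ratio of these bounds. *)
Lemma cutoff_quasimode : exists2 K : R, 0 <= K &
  forall (V : 'rV[R]_n -> R) (c : R) (a : 'rV[R]_n) (L e : R), 0 < L -> 0 <= e ->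
  (forall x, box a L x -> `|V x - c| <= e) ->
  let f := (fun x => (cutoff a L x)%:C%C) in
  inL2 f -> inL2 (schrodinger V f) ->
  (L2norm (fun x => c%:C%C * f x - schrodinger V f x)%R <= (K * (L ^- 2 + e))%:E * L2norm f)%E.
Proof.
have [M M0 hM] := cutoff_bounds.
pose m := expR (- 4) ^+ n : R.
have m0 : 0 < m by rewrite exprn_gt0 ?expR_gt0.
exists (M / m * 2 ^+ n) => [|V c a L e L0 e0 hV f Lf LVf].
  by apply: mulr_ge0; [exact: divr_ge0 (ltW m0)|exact: exprn_ge0].
have LD : inL2 (fun x => c%:C%C * f x - schrodinger V f x) by exact: inL2_Zsub.
have dE x : c%:C%C * f x - schrodinger V f x =
    (laplacian (cutoff a L) x - (V x - c) * cutoff a L x)%:C%C.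
  have -> : f = fun x => (1 * cutoff a L x)%:C%C.
    by apply/funext => y; rewrite mul1r.
  by rewrite schrodinger_cutoff mul1r -rmorphM -rmorphB; congr (_ %:C)%C; ring.
have Le0 : 0 <= M * (L ^- 2 + e).
  by rewrite mulr_ge0// addr_ge0// invr_ge0 exprn_ge0// ltW.
have ubox x : box a L x ->
    normc (c%:C%C * f x - schrodinger V f x) <= M * (L ^- 2 + e).
  move=> bx; rewrite dE normc_real (le_trans (ler_normB _ _))// mulrDr lerD//.
    by have [_] := hM a L x L0.
  by rewrite normrM mulrC ler_pM//; [have [] := hM a L x L0|exact: hV].
have uout x : ~ box a L x -> c%:C%C * f x - schrodinger V f x = 0.
  by move=> nbx; rewrite dE cutoff_out// laplacian_cutoff_out// mulr0 subr0.
have lbox x : box a (L / 2) x -> m <= normc (f x).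
  by move=> bx; rewrite normc_real; apply: le_trans (ler_norm _); exact: cutoff_ge.
have L20 : 0 < L / 2 by rewrite divr_gt0.
have ub := L2norm_sqr_le L0 Le0 ubox uout.
have := L2norm_sqr_ge L20 (ltW m0) lbox.
rewrite [2 * (L / 2)]mulrC divfK//.
move: ub; rewrite (L2norm_fin Lf) (L2norm_fin LD) -EFinM -!EFin_expe !lee_fin.
set F := fine (L2norm f); set D := fine _ => ub lb.
have F0 : 0 <= F by rewrite fine_ge0 ?L2norm_ge0.
have D0 : 0 <= D by rewrite fine_ge0 ?L2norm_ge0.
rewrite -(@ler_pXn2r _ 2)// ?nnegrE//; last first.
  rewrite mulr_ge0// mulr_ge0//; last by rewrite addr_ge0// invr_ge0 exprn_ge0// ltW.
  by apply: mulr_ge0; [exact: divr_ge0 (ltW m0)|exact: exprn_ge0].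
apply: le_trans ub _.
rewrite (_ : (M / m * 2 ^+ n * (L ^- 2 + e) * F) ^+ 2 = (M * (L ^- 2 + e)) ^+ 2 * (2 ^+ n * (2 ^+ n * (m ^- 2 * F ^+ 2)))).
  rewrite ler_wpM2l ?sqr_ge0//.
  rewrite exprMn ler_wpM2l ?exprn_ge0//.
  rewrite -[leLHS]mul1r; apply: ler_pM => //; first by rewrite exprn_ge0// ltW.
    by rewrite exprn_ege1// ler1n.
  by rewrite mulrC ler_pdivlMr ?exprn_gt0// mulrC.
by rewrite !exprMn exprVn; ring.
Qed.
End cutoff.

(** * Distance on the sphere *)

Lemma is_deriveZl (R : realType) (W : normedModType R) (k : R -> R) (f : W) (t k' : R) :
  is_derive t 1 k k' -> is_derive t 1 (fun z => k z *: f) (k' *: f).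
Proof.
move=> [/derivable1_diffP dk <-].
have dkf := differentiableZl f dk.
apply: DeriveDef; first exact/derivable1_diffP.
by rewrite deriveE// diffZl// -deriveE.
Qed.

(** The chord from theta to eta is t |-> theta + t d with d = eta - theta.  With
D = |d|^2, its squared norm at t is q t = 1 - D t + D t^2, which stays away from
0 for all real t as soon as D <= 1; hence the radial projection c of the whole
line is smooth.  Here s = q^(-1/2), and s', c' are the derivatives of s, c. *)
Section sphere.
Variables (R : realType) (n : nat) (theta eta : 'rV[R]_n).
Hypotheses (theta1 : enorm theta = 1) (eta1 : enorm eta = 1)
  (close : enorm (eta - theta) <= 1).

Let d : 'rV[R]_n := eta - theta.
Let D : R := enorm d ^+ 2.
Let q (t : R) : R := 1 - D * t + D * t ^+ 2.
Let s (t : R) : R := (Num.sqrt (q t))^-1.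
Let s' (t : R) : R := (D / 2 - D * t) * s t ^+ 3.
Let c (t : R) : 'rV[R]_n := s t *: theta + (t * s t) *: d.
Let c' (t : R) : 'rV[R]_n := s' t *: theta + (s t + t * s' t) *: d.

Let D_le1 : D <= 1.
Proof. by rewrite /D expr_le1// enorm_ge0. Qed.

(* expand |eta|^2 = |theta + d|^2 *)
Let dot_theta_d : \sum_(i < n) theta ord0 i * d ord0 i = - (D / 2).
Proof.
have : enorm eta ^+ 2 = enorm (theta + d) ^+ 2 by rewrite /d addrC subrK.
rewrite eta1 enorm_sqr; under eq_bigr do rewrite mxE sqrrD -mulr_natr.
rewrite big_split/= big_split/= -!enorm_sqr theta1 -mulr_suml -/D; lra.
Qed.

Let enorm_segment (a b : R) :
  enorm (a *: theta + b *: d) ^+ 2 = a ^+ 2 - a * b * D + b ^+ 2 * D.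
Proof.
rewrite enorm_sqr (eq_bigr (fun i => a ^+ 2 * theta ord0 i ^+ 2 +
  ((2 * a * b) * (theta ord0 i * d ord0 i) + b ^+ 2 * d ord0 i ^+ 2))); last first.
  by move=> i _; rewrite /d !mxE; ring.
rewrite big_split/= big_split/= -!mulr_sumr dot_theta_d -!enorm_sqr theta1 -/D; by field.
Qed.

Let q_ge t : 4^-1 <= q t.
Proof.
have D0 : 0 <= D by exact: sqr_ge0.
have D1 := D_le1.
rewrite /q (_ : 1 - D * t + D * t ^+ 2 = D * (t - 2^-1) ^+ 2 + (1 - D / 4)); last by field.
have : 0 <= D * (t - 2^-1) ^+ 2 by rewrite mulr_ge0 ?sqr_ge0.
by move: (D * _) => z z0; lra.
Qed.

Let q_gt0 t : 0 < q t.
Proof. by apply: lt_le_trans (q_ge t); rewrite invr_gt0. Qed.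

Let s_sqr t : s t ^+ 2 = (q t)^-1.
Proof. by rewrite /s exprVn sqr_sqrtr// ltW// q_gt0. Qed.

Let is_derive_s (t : R) : is_derive t 1 s (s' t).
Proof.
have dq : is_derive t 1 q (- D + D * (2 * t)).
  have d1 : is_derive t 1 (fun t : R => D * t) D.
    by apply: is_derive_eq (is_deriveZ D (is_derive_id t 1)) _; rewrite /GRing.scale/= mulr1.
  have d2 : is_derive t 1 (fun t : R => D * t ^+ 2) (D * (2 * t)).
    have dM := is_deriveM (is_derive_id t 1) (is_derive_id t 1).
    apply: is_derive_eq (is_deriveZ D dM) _.
    by rewrite /GRing.scale/=; ring.
  apply: is_derive_eq (is_deriveD (is_deriveB (is_derive_cst _ _ _) d1) d2) _.
  by rewrite sub0r.
have ds := @is_derive1_comp _ (@Num.sqrt R) q t _ _ (is_derive1_sqrt (q_gt0 t)) dq.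
have sq0 : Num.sqrt (q t) != 0 by rewrite gt_eqF// sqrtr_gt0 q_gt0.
apply: is_derive_eq (is_deriveV (f := fun z : R => Num.sqrt (q z)) sq0 ds) _.
rewrite /GRing.scale/= /s' /s !invfM.
by move: (Num.sqrt _)^-1 => z; field.
Qed.

Let is_derive_ts (t : R) : is_derive t 1 (fun t => t * s t) (s t + t * s' t).
Proof.
have ds := is_derive_s t.
apply: is_derive_eq (is_deriveM (is_derive_id t 1) ds) _.
by rewrite /GRing.scale/= mulr1 addrC.
Qed.

Let is_derive_c (t : R) : is_derive t 1 c (c' t).
Proof.
by apply: is_deriveD; apply: is_deriveZl; [exact: is_derive_s|exact: is_derive_ts].
Qed.

Let continuous_s : continuous s.
Proof.
move=> t; apply/differentiable_continuous/derivable1_diffP.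
by have [] := is_derive_s t.
Qed.

Let continuous_c' : continuous c'.
Proof.
have cs' : continuous s'.
  move=> t; apply: cvgM; last by do 2 (apply: cvgM; first exact: continuous_s); exact: continuous_s.
  by apply: cvgB; [exact: cvg_cst|apply: cvgM; [exact: cvg_cst|exact: cvg_id]].
move=> t; apply: cvgD; apply: cvgZr_tmp; first exact: cs'.
apply: cvgD; first exact: continuous_s.
by apply: cvgM; [exact: cvg_id|exact: cs'].
Qed.

Let enorm_c t : enorm (c t) = 1.
Proof.
apply/eqP; rewrite -(@eqrXn2 _ 2)// ?enorm_ge0//; apply/eqP.
rewrite enorm_segment expr1n.
rewrite (_ : _ + _ = s t ^+ 2 * q t); last by rewrite /q; ring.
by rewrite s_sqr mulVf// gt_eqF// q_gt0.
Qed.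

(** The velocity is the component of d orthogonal to the curve, divided by the
distance sqrt (q t) >= 1/2 of the chord to the origin; so its norm is at most
2 |d|. *)
Let enorm_c' t : enorm (c' t) <= 2 * enorm d.
Proof.
rewrite -(@ler_pXn2r _ 2)// ?nnegrE ?mulr_ge0 ?enorm_ge0//.
rewrite enorm_segment [leRHS]exprMn -/D.
pose k := D / 2 - D * t.
have qn : q t != 0 by rewrite gt_eqF// q_gt0.
(* c' is the part of s d tangent to the sphere; its radial part is - k s^2 *)
apply: (@le_trans _ _ (D * s t ^+ 2)).
  rewrite (_ : _ + _ = D * s t ^+ 2 - 2 * k * s t * s' t + s' t ^+ 2 * q t); last first.
    by rewrite /k /q; field.
  have sq1 : s t ^+ 2 * q t = 1 by rewrite s_sqr mulVf.
  have -> : s' t ^+ 2 * q t = (k * s t ^+ 2) ^+ 2 * (s t ^+ 2 * q t) by rewrite /s' -/k; ring.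
  have -> : 2 * k * s t * s' t = 2 * (k * s t ^+ 2) ^+ 2 by rewrite /s' -/k; ring.
  rewrite sq1; have := sqr_ge0 (k * s t ^+ 2).
  by move: (_ ^+ 2) (D * _) => u v; lra.
rewrite mulrC ler_wpM2r// ?sqr_ge0// s_sqr.
rewrite -[leRHS]invrK lef_pV2 ?posrE ?invr_gt0 ?exprn_gt0 ?q_gt0//.
by apply: le_trans (q_ge t); rewrite lef_pV2 ?posrE ?exprn_gt0//; lra.
Qed.

Lemma sphere_dist_le : (sphere_dist theta eta <= (2 * enorm (eta - theta))%:E)%E.
Proof.
have D1c : (fun t => 'D_1 c t) = c'.
  by apply/funext => t; have [_ ->] := is_derive_c t.
apply: (@le_trans _ _ (curve_length c)).
  apply: ereal_inf_lbound; exists c => //; split.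
  - by move=> t; have [] := is_derive_c t.
  - by rewrite D1c; exact: continuous_c'.
  - by move=> t _; exact: enorm_c.
  - have q0 : q 0 = 1 by rewrite /q; ring.
    by rewrite /c mul0r scale0r addr0 /s q0 sqrtr1 invr1 scale1r.
  - have q1 : q 1 = 1 by rewrite /q; ring.
    by rewrite /c mul1r /s q1 sqrtr1 invr1 !scale1r /d addrC subrK.
rewrite /curve_length.
apply: (@le_trans _ _ (\int[@lebesgue_measure R]_(t in `[0%R, 1%R]) (cst (2 * enorm d)%:E t))%E).
  apply: ge0_le_integralW => t _; rewrite lee_fin ?enorm_ge0//.
  by have [_ ->] := is_derive_c t; exact: enorm_c'.
rewrite integral_cst//= lebesgue_measure_itv/= lte_fin ltr01.
by rewrite oppr0 adde0 mule1.
Qed.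

End sphere.

(** * Cubes in the horn *)

Section geometry.
Variables (R : realType) (n : nat).

(** The cube has Euclidean radius at most nL, and replacing r theta0 by
|x| theta0 costs at most another nL. *)
Lemma box_polar (theta0 x : 'rV[R]_n) (r L : R) : enorm theta0 = 1 ->
  0 <= r -> box (r *: theta0) L x ->
  `|enorm x - r| <= n%:R * L /\
  (0 < enorm x -> enorm ((enorm x)^-1 *: x - theta0) <= 2 * (n%:R * L) / enorm x).
Proof.
move=> th1 r0 bx.
have dx : enorm (x - r *: theta0) <= n%:R * L.
  apply: le_trans (enorm_le_sum _) _.
  apply: (@le_trans _ _ (\sum_(i < n) L)); last first.
    by rewrite sumr_const card_ord mulr_natl.
  apply: ler_sum => i _; have := bx i; rewrite /ball/= !mxE distrC.
  exact: ltW.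
have er : enorm (r *: theta0) = r by rewrite enormZ th1 mulr1 ger0_norm.
have dr : `|enorm x - r| <= n%:R * L.
  rewrite ler_norml; apply/andP; split.
    have := ler_enormD (r *: theta0 - x) x.
    by rewrite subrK er -opprB enormN; lra.
  by have := ler_enormD (x - r *: theta0) (r *: theta0); rewrite subrK er; lra.
split => // x0.
have -> : (enorm x)^-1 *: x - theta0 = (enorm x)^-1 *: ((x - r *: theta0) + (r - enorm x) *: theta0).
  by apply/rowP => i; rewrite !mxE; field; rewrite gt_eqF.
rewrite enormZ ger0_norm ?invr_ge0 ?enorm_ge0// mulrC ler_wpM2r ?invr_ge0 ?enorm_ge0//.
apply: le_trans (ler_enormD _ _) _; rewrite enormZ th1 mulr1 distrC.
by rewrite mulr_natl mulr2n lerD.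
Qed.

(** The centre is (rho + nL) theta0, which puts every point of the cube at
distance at least rho from the origin; rho only has to be large in terms of L
and e.  For the horn condition, the spherical distance to theta0 is at most
4nL / |x|, which is less than C |x|^(-l) once |x|^(1-l) > 4nL / C. *)
Lemma box_in_horn (V Vinf Vs : 'rV[R]_n -> R) (rad C l : R) (theta0 : 'rV[R]_n)
    (L e : R) :
  (forall x, V x = Vinf x + Vs x) -> {for theta0, continuous Vinf} ->
  (forall x, 1 <= enorm x -> Vinf x = Vinf ((enorm x)^-1 *: x)) ->
  o_inv_norm Vs -> 0 < C -> l < 1 -> enorm theta0 = 1 ->
  0 < L -> 0 < e ->
  exists a : 'rV[R]_n, forall x, box a L x ->
    horn rad C l theta0 x /\ `|V x - Vinf theta0| <= e.
Proof.
move=> V_split Vinf_cont Vinf_hom Vs_decay C0 l1 th1 L0 e0.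
have [M VsM] := Vs_decay 1 ltr01.
have e20 : 0 < e / 2 by rewrite divr_gt0.
have /cvgrPdist_lt/(_ _ e20)/nbhs_ballP[d /= d0 hd] := Vinf_cont.
pose k := n%:R * L; have k0 : 0 <= k by rewrite mulr_ge0// ltW.
(* each summand of rho serves one requirement: |x| >= 1 for the homogeneity,
   |x| > rad, |x| > M for the decay of Vs, A for the width of the horn, 2k for
   the projected chord to be defined, 4k / d for x / |x| to be d-close to theta0,
   and 2 / e for |Vs x| <= e / 2 *)
pose A := ((4 * k + 1) / C) `^ ((1 - l)^-1).
pose rho := 1 + `|rad| + `|M| + A + 2 * k + 4 * k / d + 2 / e.
have A0 : 0 <= A by exact: powR_ge0.
have kd0 : 0 <= 4 * k / d by rewrite divr_ge0 ?mulr_ge0// ltW.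
have ie0 : 0 < 2 / e by rewrite divr_gt0.
have r0 := normr_ge0 rad; have M0 := normr_ge0 M.
have rrad := ler_norm rad; have rM := ler_norm M.
exists ((rho + k) *: theta0) => x bx.
have rk0 : 0 <= rho + k by rewrite /rho; lra.
have [dr dth] := box_polar th1 rk0 bx.
have xrho : rho <= enorm x by move: dr; rewrite -/k ler_norml; lra.
move: xrho; rewrite /rho => xrho.
have x1 : 1 <= enorm x by lra.
have x0 : 0 < enorm x by lra.
have {dth} := dth x0; set th := (enorm x)^-1 *: x => dth.
have eth : enorm th = 1 by rewrite enormZ ger0_norm ?invr_ge0 ?enorm_ge0// mulVf// gt_eqF.
have dth' : enorm (theta0 - th) <= 2 * k / enorm x by rewrite -opprB enormN.
split.
  split; first by lra.
  have close : enorm (theta0 - th) <= 1.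
    by apply: le_trans dth' _; rewrite ler_pdivrMr// mul1r; lra.
  apply: le_lt_trans (sphere_dist_le eth th1 close) _.
  rewrite lte_fin; apply: (@le_lt_trans _ _ (4 * k / enorm x)).
    rewrite (_ : 4 * k / _ = 2 * (2 * k / enorm x)) ?ler_pM2l//; ring.
  have -> : (enorm x) `^ (- l) = (enorm x) `^ (1 - l) / enorm x.
    rewrite powRD; last by rewrite (gt_eqF x0) implybT.
    rewrite powRr1 ?(ltW x0)// mulrAC divff ?mul1r//.
    by rewrite gt_eqF.
  rewrite mulrA ltr_pM2r ?invr_gt0//.
  have Ax : A <= enorm x by lra.
  have l10 : 0 < 1 - l by lra.
  have : A `^ (1 - l) <= (enorm x) `^ (1 - l).
    by rewrite ge0_ler_powR ?nnegrE ?(ltW l10)// ?(ltW x0).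
  rewrite /A -powRrM mulVf ?gt_eqF// powRr1; last by rewrite divr_ge0 ?(ltW C0)//; lra.
  rewrite ler_pdivrMr// mulrC; lra.
rewrite V_split Vinf_hom// -/th addrAC (splitr e) (le_trans (ler_normD _ _))// lerD//.
  rewrite distrC ltW//; apply: hd; split => //= i j.
  rewrite (ord1 i) /ball/=.
  have -> : theta0 ord0 j - th ord0 j = (theta0 - th) ord0 j by rewrite !mxE.
  apply: le_lt_trans (ler_coord_enorm _ _) _; apply: le_lt_trans dth' _.
  by rewrite ltr_pdivrMr// [ltRHS]mulrC -ltr_pdivrMr//; lra.
have Mx : M < enorm x by lra.
apply: le_trans (VsM _ Mx) _; rewrite mul1r.
rewrite -[leRHS]invrK lef_pV2 ?posrE ?invr_gt0//.
rewrite invf_div; lra.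
Qed.
End geometry.

(** * Observed energy of quasimodes *)

Section energy.
Variables (R : realType) (n : nat).

(** On Omega, |U_t f| = |U_t f - z f| because f vanishes there, so the energy at
time t is at most (t b + T b)^2, the term T b being the admitted error in
quasimode_evolution. *)
Lemma observed_energy_le (P : ('rV[R]_n -> R[i]) -> ('rV[R]_n -> R[i]) -> Prop)
  (U : R -> ('rV[R]_n -> R[i]) -> ('rV[R]_n -> R[i])) (Omega : set 'rV[R]_n)
  (T c b : R) f g : generated_by P U -> P f g ->
  (forall x, Omega x -> f x = 0) -> 0 < T -> 0 < b ->
  (L2norm (fun x => c%:C%C * f x - g x)%R <= b%:E)%E ->
  (observed_energy U Omega T f <= (T * (2 * T * b) ^+ 2)%:E)%E.
Proof.
move=> UP Pfg f0 T0 b0 hb.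
have [UU PU] := UP; have [Lf Lg _] := (PU f g).1 Pfg.
rewrite /observed_energy.
apply: (@le_trans _ _ (\int[@lebesgue_measure R]_(t in `[0%R, T]) (cst ((2 * T * b) ^+ 2)%:E t))%E); last first.
  rewrite integral_cst//= lebesgue_measure_itv/= lte_fin T0 oppr0 adde0 -EFinM lee_fin.
  by rewrite mulrC.
apply: ge0_le_integralW => t.
  by move=> _; apply: integral_ge0 => x _; rewrite lee_fin sqr_ge0.
rewrite /= in_itv/= => /andP[t0 tT].
have [z hz] := quasimode_evolution c UP Pfg t0 (mulr_gt0 T0 b0).
pose w x := U t f x - z * f x.
apply: (@le_trans _ _ (L2norm w ^+ 2)%E).
  rewrite L2norm_sqr.
  rewrite [leLHS]integral_mkcond; apply: ge0_le_integralW => x _.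
    by apply: erestrict_ge0 => y _; rewrite lee_fin sqr_ge0.
  rewrite patchE; case: ifPn => [|_]; last by rewrite lee_fin sqr_ge0.
  by rewrite inE => Ox; rewrite /w f0// mulr0 subr0.
have b20 : 0 <= 2 * T * b by rewrite !mulr_ge0 ?(ltW T0) ?(ltW b0).
rewrite EFin_expe lee_sqr ?L2norm_ge0 ?lee_fin//.
apply: (le_trans hz); apply: (@le_trans _ _ (T%:E * b%:E + (T * b)%:E)%E).
  rewrite leeD2r//; apply: lee_pmul => //; rewrite ?lee_fin//.
  exact: L2norm_ge0.
by rewrite -EFinM -EFinD lee_fin; lra.
Qed.
End energy.

Section normalized.
Variables (R : realType) (n : nat).

Lemma normalized_quasimode : exists2 K : R, 0 <= K &
  forall (V : 'rV[R]_n -> R) (P : ('rV[R]_n -> R[i]) -> ('rV[R]_n -> R[i]) -> Prop)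
    (c : R) (a : 'rV[R]_n) (L e : R),
  (forall f, test_function f -> P f (schrodinger V f)) ->
  (forall f g, P f g -> inL2 f /\ inL2 g) ->
  0 < L -> 0 <= e -> (forall x, box a L x -> `|V x - c| <= e) ->
  exists u v, [/\ P u v, L2norm u = 1%E, (forall x, ~ box a L x -> u x = 0) &
    (L2norm (fun x => c%:C%C * u x - v x)%R <= (K * (L ^- 2 + e))%:E)%E].
Proof.
have [K K0 hK] := cutoff_quasimode R n; exists K => // V P c a L e PV PL2 L0 e0 hV.
set f := (fun x => (cutoff a L x)%:C%C).
have fE1 : f = (fun x => (1 * cutoff a L x)%:C%C).
  by apply/funext => x; rewrite mul1r.
have Pf : P f (schrodinger V f) by apply: PV; rewrite fE1; exact: test_function_cutoff.
have [Lf LVf] := PL2 _ _ Pf.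
have f0 := L2norm_cutoff_gt0 a L0; rewrite -/f in f0.
have fE := L2norm_fin Lf.
set F := fine (L2norm f) in fE.
have F0 : 0 < F by rewrite -lte_fin -fE.
pose u := (fun x => (F^-1 * cutoff a L x)%:C%C).
have uE : u = (fun x => (F^-1)%:C%C * f x).
  by apply/funext => x; rewrite /u rmorphM.
have vE : schrodinger V u = (fun x => (F^-1)%:C%C * schrodinger V f x).
  by apply/funext => x; rewrite fE1 !schrodinger_cutoff mul1r rmorphM.
exists u, (schrodinger V u); split.
- by apply: PV; exact: test_function_cutoff.
- rewrite uE L2normZ// normc_real gtr0_norm ?invr_gt0// fE -EFinM mulVf// gt_eqF//.
- by move=> x nbx; rewrite /u cutoff_out// mulr0.
have LD : inL2 (fun x => c%:C%C * f x - schrodinger V f x) by exact: inL2_Zsub.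
rewrite vE uE (_ : (fun x => _) = (fun x => (F^-1)%:C%C * (c%:C%C * f x - schrodinger V f x))%R).
  rewrite L2normZ// normc_real gtr0_norm ?invr_gt0//.
  apply: (@le_trans _ _ ((F^-1)%:E * ((K * (L ^- 2 + e))%:E * L2norm f))%E).
    by rewrite lee_wpmul2l ?lee_fin ?invr_ge0 ?(ltW F0)//; exact: hK.
  by rewrite fE -!EFinM lee_fin mulrCA mulVf ?mulr1// gt_eqF.
by apply/funext => x; ring.
Qed.

End normalized.

(** * Failure of observability *)

Theorem theorem1p5 (R : realType) (n : nat) (V Vinf Vs : 'rV[R]_n -> R)
  (P : ('rV[R]_n -> R[i]) -> ('rV[R]_n -> R[i]) -> Prop)
  (U : R -> ('rV[R]_n -> R[i]) -> ('rV[R]_n -> R[i]))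
  (Omega : set 'rV[R]_n) (rad C l : R) (theta0 : 'rV[R]_n)
  (hn : (0 < n)%N)
  (V_smooth : smooth V)
  (V_split : forall x, V x = Vinf x + Vs x)
  (Vinf_smooth : smooth Vinf)
  (Vinf_homogeneous :
     forall x, 1 <= enorm x -> Vinf x = Vinf ((enorm x)^-1 *: x))
  (Vs_decay : o_inv_norm Vs)
  (P_schrodinger : schrodinger_operator V P)
  (U_generated : generated_by P U)
  (Omega_domain : euclidean_domain Omega)
  (rad_gt0 : 0 < rad) (C_gt0 : 0 < C) (l_gt0 : 0 < l) (l_lt1 : l < 1)
  (theta0_sphere : enorm theta0 = 1)
  (Omega_horn : Omega `&` [set x | rad < enorm x] `<=` ~` horn rad C l theta0) :
  forall T : R, 0 < T ->
    ~ observability U Omega T /\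
    exists u : nat -> ('rV[R]_n -> R[i]),
      [/\ (forall m, inL2 (u m)),
          (forall m, L2norm (u m) = 1%E) &
          observed_energy U Omega T (u m) @[m --> \oo] --> 0%E].
Proof.
move=> T T0.
have [K K0 hK] := normalized_quasimode R n.
pose Q := T * (4 * T * (K + 1)) ^+ 2.
have Q0 : 0 < Q by rewrite mulr_gt0// exprn_gt0// !mulr_gt0// ltr_wpDl.
have Vinf_cont : {for theta0, continuous Vinf}.
  exact/differentiable_continuous/(Vinf_smooth [::]).
have energy_ge0 f : (0 <= observed_energy U Omega T f)%E.
  by apply: integral_ge0 => t _; apply: integral_ge0 => x _; rewrite lee_fin sqr_ge0.
(* half-side L = m + 1 and tolerance e = 1 / (m + 1) *)
have /choice[u hu] (m : nat) : exists u, [/\ inL2 u, L2norm u = 1%E &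
    (observed_energy U Omega T u <= (Q * m.+1%:R^-1)%:E)%E].
  have m0 : 0 < m.+1%:R :> R by rewrite ltr0n.
  have im0 : 0 < m.+1%:R^-1 :> R by rewrite invr_gt0.
  have im1 : m.+1%:R^-1 <= 1 :> R by rewrite invf_le1// ler1n.
  have [a ha] := box_in_horn rad V_split Vinf_cont Vinf_homogeneous Vs_decay
    C_gt0 l_lt1 theta0_sphere m0 im0.
  have PL2 f g : P f g -> inL2 f /\ inL2 g by move/(U_generated.2 f g) => [].
  have [w [v [Pw w1 wout wc]]] := hK V P (Vinf theta0) a m.+1%:R m.+1%:R^-1
    P_schrodinger.2 PL2 m0 (ltW im0) (fun x bx => (ha x bx).2).
  exists w; split => //; first by have [] := PL2 _ _ Pw.
  have w_Omega x : Omega x -> w x = 0.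
    move=> Ox; apply: wout => bx; have [hx _] := ha x bx.
    by apply: (Omega_horn x) => //; split => //; have [] := hx.
  have b0 : 0 < 2 * (K + 1) * m.+1%:R^-1 by rewrite !mulr_gt0// ltr_wpDl.
  apply: le_trans (observed_energy_le U_generated Pw w_Omega T0 b0 (le_trans wc _)) _.
    rewrite lee_fin; move: im0 im1; rewrite -exprVn; move: (_^-1) => z z0 z1.
    have zz : z ^+ 2 <= z by rewrite expr2 ler_piMl// ltW.
    apply: (@le_trans _ _ (K * (2 * z))); first by rewrite ler_wpM2l//; lra.
    by rewrite (_ : 2 * (K + 1) * z = K * (2 * z) + 2 * z); [rewrite lerDl; lra|ring].
  rewrite lee_fin /Q -[leRHS]mulrA ler_pM2l//.
  move: im0 im1; move: (_^-1) => z z0 z1.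
  rewrite (_ : 2 * T * _ = (4 * T * (K + 1)) * z); last by ring.
  by rewrite exprMn ler_wpM2l ?sqr_ge0// expr2 ler_piMl// ltW.
have Qcvg : (Q * m.+1%:R^-1)%:E @[m --> \oo] --> 0%E.
  apply: cvg_EFin; first by near=> m.
  rewrite -[0](mulr0 Q); apply: cvgM; first exact: cvg_cst.
  exact: cvg_harmonic.
split; last first.
  exists u; split => [m|m|]; [by have [] := hu m|by have [] := hu m|].
  apply: squeeze_cvge (cvg_cst _) Qcvg.
  by near=> m; rewrite energy_ge0; have [] := hu m.
(* observability would give 1 <= B Q / (m + 1) for all m *)
move=> [B [B0 hB]].
pose m := Num.truncn (B * Q); have [um u1 ue] := hu m.
have := hB _ um; rewrite u1 expe2 mule1 leNgt => /negP; apply.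
apply: (@le_lt_trans _ _ (B%:E * (Q * m.+1%:R^-1)%:E)%E).
  by rewrite lee_pmul2l// lte_fin.
rewrite -EFinM lte_fin mulrA ltr_pdivrMr ?ltr0n// mul1r.
exact: truncnS_gt.
Unshelve. all: by end_near. Qed.
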